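(* Let $Y\subset\mathbb{P}^5$ be a cubic fourfold having a singularity that deforms to $\widetilde{E}_6$. Then $Y$ is of type S6. In particular, $Y$ is not stable.
   Context: We work over $\mathbb{C}$. A cubic fourfold is a hypersurface in $\mathbb{P}^5$ given by a nonzero cubic form in $x_0,\dots,x_5$. Stability (meaning proper stability) is in the GIT sense for $\mathrm{SL}(6)$ acting on $\mathbb{P}(\mathrm{Sym}^3W)$, $W=H^0(\mathbb{P}^5,\mathcal{O}(1))$. $Y$ is of type S6 if in suitable linear coordinates its equation is a linear combination of cubic monomials $x_0^{i_0}\cdots x_5^{i_5}$ of weight $\sum i_ja_j\le0$, where $(a_0,\dots,a_5)=(2,0,0,0,-1,-1)$; equivalently it has the form $x_0q(x_4,x_5)+f(x_1,\dots,x_5)$. $\widetilde{E}_6$ is the class of germs in $(\mathbb{C}^5,0)$ given by $y_1^3+y_2^3+y_3^3+ay_1y_2y_3+y_4^2+y_5^2=0$, $a^3+27\neq0$. A singularity deforms to $\widetilde{E}_6$ if there are arbitrarily small deformations of the germ having, arbitrarily near the original point, a singular point of class $\widetilde{E}_6$ (including the case where the germ itself is of that class). *)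

(* Defs.v *)
From HB Require Import structures.
From mathcomp Require Import all_boot all_order all_algebra.
From mathcomp Require mpoly.
From mathcomp Require Import finmap classical_sets cardinality.
From mathcomp Require topology normedtype summability.

Set Implicit Arguments.
Unset Strict Implicit.
Unset Printing Implicit Defensive.

Import Order.TTheory GRing.Theory Num.Theory.
Local Open Scope ring_scope.

(* The imports of [mpoly] and of the topology files are confined to modules:  *)
(* their notations cannot be active at the same time.                         *)

Module CubicForms.
Import mpoly.
Local Open Scope classical_set_scope.

Section CubicForms.
Variable K : fieldType.
Implicit Types (F G H : {mpoly K[6]}) (g : 'M[K]_6) (x : 'rV[K]_6).

Definition cubic_form F := F != 0 /\ F \is 3.-homog.

(* x |-> F (g x).  This is a right action of the matrices; replacing g by     *)
(* g^-1 makes it a left action and changes neither orbits nor finiteness of   *)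
(* stabilisers.                                                               *)
Definition linsubst g F : {mpoly K[6]} :=
  F \mPo [tuple \sum_(j < 6) g i j *: 'X_j | i < 6].

Definition singular_point F x :=
  [/\ x != 0, F.@[fun j => x 0 j] = 0
    & forall i : 'I_6, (F^`M(i)).@[fun j => x 0 j] = 0].

(* The point (y_0 : ... : y_(i-1) : 1 : y_i : ... : y_4) of P^5.              *)
Definition affine_chart (i : 'I_6) (y : 'rV[K]_5) : 'rV[K]_6 :=
  \row_j (if unlift i j is Some k then y 0 k else 1).

Definition local_equation F (i : 'I_6) (y : 'rV[K]_5) : K :=
  F.@[fun j => affine_chart i y 0 j].

Definition S6_weights : seq int := [:: 2; 0; 0; 0; -1; -1].

Definition S6_weight (m : 'X_{1..6}) : int :=
  \sum_(j < 6) (m j)%:Z * S6_weights`_j.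

Definition type_S6 F :=
  exists2 g, g \in unitmx &
    forall m : 'X_{1..6}, m \in msupp (linsubst g F) -> S6_weight m <= 0.

(* Polynomial functions on Sym^3 W, in the coordinates given by the           *)
(* coefficients of a cubic form.                                              *)
Definition cubic_monomials : {set 'X_{1..6 < 4}} :=
  [set m : 'X_{1..6 < 4} | mdeg m == 3]%SET.

Definition cubic_coefs F (k : 'I_#|cubic_monomials|) : K :=
  F@_(bmnm (enum_val k)).

Definition eval_at_form (P : {mpoly K[#|cubic_monomials|]}) F : K :=
  P.@[cubic_coefs F].

Definition SL_invariant (P : {mpoly K[#|cubic_monomials|]}) :=
  forall g F, \det g = 1 -> cubic_form F ->
    eval_at_form P (linsubst g F) = eval_at_form P F.

(* [G] lies in the SL(6)-orbit of [F] in P(Sym^3 W).                          *)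
Definition same_orbit F G :=
  exists g c, [/\ \det g = 1, c != 0 & G = c *: linsubst g F].

Definition nonvanishing_locus (P : {mpoly K[#|cubic_monomials|]}) F :=
  cubic_form F /\ eval_at_form P F != 0.

(* The orbit of [F] is Zariski closed in the open set P <> 0 of P(Sym^3 W).   *)
Definition orbit_closed_in (P : {mpoly K[#|cubic_monomials|]}) F :=
  exists E : set {mpoly K[#|cubic_monomials|]},
    (forall Q, E Q -> exists e : nat, Q \is e.-homog) /\
    (forall G, nonvanishing_locus P G ->
       ((forall Q, E Q -> eval_at_form Q G = 0) <-> same_orbit F G)).

Definition projective_stabiliser F : set 'M[K]_6 :=
  [set g | \det g = 1 /\ exists2 c, c != 0 & linsubst g F = c *: F].

(* Mumford's proper stability for the linearisation O(1) of P(Sym^3 W).       *)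
Definition properly_stable F :=
  (exists (d : nat) (I : {mpoly K[#|cubic_monomials|]}),
    [/\ (0 < d)%N, I \is d.-homog, SL_invariant I, nonvanishing_locus I F
      & forall G, nonvanishing_locus I G -> orbit_closed_in I G]) /\
  finite_set (projective_stabiliser F).

End CubicForms.
End CubicForms.

Module Germs.
Import topology normedtype summability.
Import numFieldNormedType.Exports.
Local Open Scope classical_set_scope.

Section Germs.
Variable K : numFieldType.

Definition monomial_at n (m : {ffun 'I_n -> nat}) (h : 'rV[K]_n) : K :=
  \prod_(i < n) h 0 i ^+ m i.

(* f is, near w, the sum of an (absolutely) convergent power series centred   *)
(* at w; [totally] is the filter of unconditional summation over the          *)
(* multi-indices.                                                             *)
Definition holomorphic_near n (f : 'rV[K]_n -> K) (w : 'rV[K]_n) :=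
  exists a : {ffun 'I_n -> nat} -> K,
    \forall z \near w,
      partial_sum (fun m => a m * monomial_at m (z - w)) @ totally --> f z.

Definition holomorphic_map_near n p (f : 'rV[K]_n -> 'rV[K]_p) (w : 'rV[K]_n) :=
  forall j, holomorphic_near (fun z => f z 0 j) w.

(* The hypersurface germs ({f = 0}, w) and ({h = 0}, v) are isomorphic.       *)
Definition hypersurface_germ_iso n (f : 'rV[K]_n -> K) (w : 'rV[K]_n)
    (h : 'rV[K]_n -> K) (v : 'rV[K]_n) :=
  exists (phi psi : 'rV[K]_n -> 'rV[K]_n) (u : 'rV[K]_n -> K),
    [/\ holomorphic_map_near phi v, holomorphic_map_near psi w
      & holomorphic_near u v] /\
    [/\ phi v = w, psi w = v,
        \forall z \near v, psi (phi z) = z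
      & \forall z \near w, phi (psi z) = z] /\
    [/\ u v != 0 & \forall z \near v, f (phi z) = u z * h z].

Definition E6t_equation (a : K) (z : 'rV[K]_5) : K :=
  let y k := z 0 (inord k) in
  y 0%N ^+ 3 + y 1%N ^+ 3 + y 2%N ^+ 3 + a * y 0%N * y 1%N * y 2%N
    + y 3%N ^+ 2 + y 4%N ^+ 2.

Definition class_E6t (f : 'rV[K]_5 -> K) (w : 'rV[K]_5) :=
  exists2 a : K, a ^+ 3 + 27 != 0 & hypersurface_germ_iso f w (E6t_equation a) 0.

(* Some holomorphic family F(y, s), s in K^k, with F(y, 0) = f(y), has points *)
(* (y, s) arbitrarily close to (w, 0) at which the fibre F(-, s) = 0 is of    *)
(* class E6~.  Any deformation of ({f = 0}, w) over a germ of complex space   *)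
(* embedded in (K^k, 0) extends to such a family.                             *)
Definition deforms_to_E6t (f : 'rV[K]_5 -> K) (w : 'rV[K]_5) :=
  exists (k : nat) (F : 'rV[K]_(5 + k) -> K),
    [/\ holomorphic_near F (row_mx w 0),
        \forall y \near w, F (row_mx y 0) = f y
      & forall (U : set 'rV[K]_5) (V : set 'rV[K]_k), nbhs w U ->
          nbhs (0 : 'rV[K]_k) V ->
          exists y s, [/\ U y, V s & class_E6t (fun z => F (row_mx z s)) y]].

End Germs.
End Germs.

Export CubicForms Germs.

(* The point of Y = {F = 0} is [affine_chart i y], and the germ of Y there is *)
(* read off in the affine chart x_i = 1.                                      *)
Definition has_singularity_deforming_to_E6t (K : numFieldType)
    (F : mpoly.mpoly 6 K) :=
  exists (i : 'I_6) (y : 'rV[K]_5),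
    singular_point F (affine_chart i y) /\
    deforms_to_E6t (local_equation F i) y.

(* Main.v *)
From HB Require Import structures.
Require Import Defs.
From mathcomp Require Import all_boot all_order all_algebra.
From mathcomp Require mpoly.
From mathcomp Require topology normedtype summability.
From mathcomp Require Import ring.

(* A germ of class E6~ is an invertible function times a sum of two squares up
   to order 3, so its quadratic part is u0 (l^2 + l'^2) with l, l' linear.
   Second-order Taylor coefficients of a holomorphic family vary continuously
   with the base point, hence the quadratic part of Y at a singular point p
   deforming to E6~ is a limit of such forms, and having rank at most 2 is a
   closed condition.  A basis starting with p and three more vectors of the
   kernel of this quadratic part puts the equation in the form
   x_0 q(x_4, x_5) + f(x_1, ..., x_5), i.e. type S6.

   For the instability, let D(s) be the image of an S6 form under
   diag(s^-2, 1, 1, 1, s, s); it extends polynomially to s = 0.  An invariant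
   not vanishing at F does not vanish at D(0) either, so closedness of the
   orbit puts D(0) in the orbit of F, although D(0) is fixed by the whole
   one-parameter group. *)

Set Implicit Arguments.
Unset Strict Implicit.
Unset Printing Implicit Defensive.

Import Order.TTheory GRing.Theory Num.Theory.
Local Open Scope ring_scope.

(** * Rank estimates *)

Lemma rank_le_of_approx (K : numFieldType) m n (M : 'M[K]_(m, n)) (r : nat) :
  (forall e : K, 0 < e -> exists2 N : 'M[K]_(m, n), (\rank N <= r)%N &
     forall i j, `|M i j - N i j| <= e) ->
  (\rank M <= r)%N.
Proof.
move=> MN; rewrite leqNgt; apply/negP; set s := \rank M => rs.
have /row_fullP[P PM] : row_full (col_base M) := col_base_full M.
have /row_freeP[Q MQ] : row_free (row_base M) := row_base_free M.
have PMQ : P *m M *m Q = 1%:M.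
  transitivity (P *m (col_base M *m row_base M) *m Q); first by rewrite mulmx_base.
  by rewrite mulmxA PM mul1mx MQ.
pose c : K := (\sum_i \sum_k `|P i k|) * (\sum_l \sum_j `|Q l j|).
have c0 : 0 <= c by rewrite mulr_ge0// sumr_ge0// => i _; rewrite sumr_ge0.
have sc0 : 0 < s%:R * c + 1 by rewrite ltr_wpDl// mulr_ge0.
pose e := (s%:R * c + 1)^-1.
have e0 : 0 < e by rewrite invr_gt0.
have [N Nr MNe] := MN e e0.
pose D := P *m (M - N) *m Q.
have D_le i j : `|D i j| <= c * e.
  rewrite !mxE; apply: le_trans (ler_norm_sum _ _ _) _.
  have row_le l : `|(P *m (M - N)) i l| <= (\sum_i \sum_k `|P i k|) * e.
    rewrite !mxE; apply: le_trans (ler_norm_sum _ _ _) _.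
    rewrite (bigD1 i)//= mulrDl.
    apply: le_trans (_ : (\sum_k `|P i k|) * e <= _).
      rewrite mulr_suml; apply: ler_sum => k _; rewrite normrM ler_wpM2l//.
      by rewrite !mxE.
    rewrite lerDl mulr_ge0 ?(ltW e0)// sumr_ge0// => k _; exact: sumr_ge0.
  have -> : c * e = (\sum_i \sum_k `|P i k|) * e * (\sum_l \sum_j `|Q l j|).
    by rewrite /c mulrAC.
  rewrite mulr_sumr; apply: ler_sum => l _; rewrite normrM.
  apply: ler_pM => //; rewrite (bigD1 j)//= lerDl; exact: sumr_ge0.
have [v v0 vPNQ] : exists2 v : 'rV[K]_s, v != 0 & v *m (P *m N *m Q) = 0.
  have kn : kermx (P *m N *m Q) != 0.
    rewrite kermx_eq0 /row_free neq_ltn; apply/orP; left.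
    apply: leq_ltn_trans rs; apply: leq_trans Nr.
    by rewrite (leq_trans (mxrankM_maxl _ _))// mxrankM_maxr.
  exists (nz_row (kermx (P *m N *m Q))); first by rewrite nz_row_eq0.
  by apply/sub_kermxP; apply: nz_row_sub.
have vD : v = v *m D.
  by rewrite /D mulmxBr mulmxBl PMQ mulmxBr mulmx1 vPNQ subr0.
have S0 : 0 < \sum_j `|v 0 j|.
  rewrite lt_def sumr_ge0// andbT; apply: contraNneq v0.
  move/eqP; rewrite psumr_eq0// => /allP v0; apply/eqP/rowP => j; rewrite mxE.
  by apply/eqP; rewrite -normr_eq0; apply: v0; rewrite mem_index_enum.
have : \sum_j `|v 0 j| <= (\sum_j `|v 0 j|) * (s%:R * (c * e)).
  rewrite [in leLHS]vD.
  have -> : (\sum_j `|v 0 j|) * (s%:R * (c * e)) =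
    \sum_(j < s) (\sum_i `|v 0 i|) * (c * e).
    by rewrite sumr_const card_ord -mulr_natl; ring.
  apply: ler_sum => j _; rewrite mxE; apply: le_trans (ler_norm_sum _ _ _) _.
  rewrite mulr_suml; apply: ler_sum => i _; rewrite normrM ler_wpM2l//.
have lt1 : s%:R * (c * e) < 1 by rewrite mulrA ltr_pdivrMr// mul1r ltrDl.
by rewrite -{1}[\sum_j _]mulr1 ler_pM2l// (lt_geF lt1).
Qed.

Lemma rank_polarization (K : numFieldType) m n (q : 'rV[K]_n -> K)
    (x : 'I_m -> 'rV[K]_n) :
  (forall t v, q (t *: v) = t ^+ 2 * q v) ->
  (forall e : K, 0 < e -> exists (u0 : K) (l l' : 'I_n -> K),
     forall v : 'rV[K]_n, (forall j, `|v 0 j| <= 1) ->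
     `|q v - u0 * ((\sum_i l i * v 0 i) ^+ 2 + (\sum_i l' i * v 0 i) ^+ 2)| <= e) ->
  (\rank (\matrix_(i, j) (q (x i + x j) - q (x i) - q (x j)))%R <= 2)%N.
Proof.
move=> qZ qP; apply: rank_le_of_approx => e e0.
pose R := 1 + \sum_i \sum_j `|x i 0 j| + \sum_i \sum_j `|x i 0 j|.
have nn i : 0 <= \sum_j `|x i 0 j| by exact: sumr_ge0.
have nn2 : 0 <= \sum_i \sum_j `|x i 0 j| by exact: sumr_ge0.
have R0 : 0 < R by rewrite ltr_wpDr// ltr_wpDr.
have xS i j : `|x i 0 j| <= \sum_i \sum_j `|x i 0 j|.
  rewrite (bigD1 i)//= (bigD1 j)//= -addrA lerDl addr_ge0// sumr_ge0//.
have xR i j : `|x i 0 j| <= R.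
  by apply: le_trans (xS i j) _; rewrite /R lerDr addr_ge0.
have xxR i i' j : `|(x i + x i') 0 j| <= R.
  rewrite mxE; apply: le_trans (ler_normD _ _) _.
  apply: le_trans (lerD (xS i j) (xS i' j)) _.
  by rewrite /R -addrA lerDr.
have e'0 : 0 < e / (3 * R ^+ 2) by rewrite divr_gt0// mulr_gt0// exprn_gt0.
have [u0 [l [l' lP]]] := qP _ e'0.
pose L (v : 'rV[K]_n) := \sum_i l i * v 0 i.
pose L' (v : 'rV[K]_n) := \sum_i l' i * v 0 i.
have LD v w : L (v + w) = L v + L w.
  by rewrite -big_split/=; apply: eq_bigr => i _; rewrite mxE mulrDr.
have L'D v w : L' (v + w) = L' v + L' w.
  by rewrite -big_split/=; apply: eq_bigr => i _; rewrite mxE mulrDr.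
have LZ t v : L (t *: v) = t * L v.
  by rewrite mulr_sumr; apply: eq_bigr => i _; rewrite mxE mulrCA.
have L'Z t v : L' (t *: v) = t * L' v.
  by rewrite mulr_sumr; apply: eq_bigr => i _; rewrite mxE mulrCA.
have lR (v : 'rV[K]_n) : (forall j, `|v 0 j| <= R) ->
    `|q v - u0 * (L v ^+ 2 + L' v ^+ 2)| <= e / 3.
  move=> vR; have -> : v = R *: (R^-1 *: v) by rewrite scalerA mulfV ?gt_eqF// scale1r.
  rewrite qZ LZ L'Z !exprMn -mulrDr mulrCA -mulrBr normrM.
  have RR : 0 < R ^+ 2 by rewrite exprn_gt0.
  rewrite (gtr0_norm RR) mulrC -ler_pdivlMr//.
  have -> : e / 3 / R ^+ 2 = e / (3 * R ^+ 2) by field; rewrite ?gt_eqF.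
  apply: lP => j; rewrite mxE normrM gtr0_norm ?invr_gt0// mulrC.
  by rewrite ler_pdivrMr// mul1r.
pose A : 'M[K]_(m, 2) := \matrix_(i, k) (if k == 0 then L (x i) else L' (x i)).
exists ((2 * u0) *: (A *m A^T)).
  rewrite scalemxAl; apply: leq_trans (mxrankM_maxr _ _) _.
  by rewrite rank_leq_row.
move=> i j; rewrite !mxE !big_ord_recl big_ord0 !mxE/= addr0.
have := lR _ (xxR i j); have := lR _ (xR i); have := lR _ (xR j).
rewrite LD L'D; set a := L (x i); set b := L (x j).
set a' := L' (x i); set b' := L' (x j) => E1 E2 E3.
have -> : q (x i + x j) - q (x i) - q (x j) - 2 * u0 * (a * b + a' * b') =
  (q (x i + x j) - u0 * ((a + b) ^+ 2 + (a' + b') ^+ 2))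
  - (q (x i) - u0 * (a ^+ 2 + a' ^+ 2)) - (q (x j) - u0 * (b ^+ 2 + b' ^+ 2)) by ring.
apply: le_trans (ler_normB _ _) _; apply: le_trans (lerD (ler_normB _ _) E1) _.
apply: le_trans (lerD (lerD E3 E2) (lexx _)) _.
by rewrite le_eqVlt; apply/orP; left; apply/eqP; field.
Qed.

Lemma row_free_extend (K : fieldType) m n p d (A : 'M[K]_(m, n)) (B : 'M[K]_(p, n)) :
  row_free A -> (A <= B)%MS -> (m + d <= \rank B)%N ->
  exists2 C : 'M[K]_(d, n), (C <= B)%MS & row_free (col_mx A C).
Proof.
move=> Afree AB mdB; pose D := (B :\: A)%MS.
have rD : (d <= \rank D)%N.
  rewrite -(leq_add2l m) (leq_trans mdB)//.
  have := mxrank_cap_compl B A; rewrite -/D => <-.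
  by rewrite leq_add2r (leq_trans (mxrankS (capmxSr _ _)))// rank_leq_row.
pose C := (pid_mx d : 'M_(d, \rank D)) *m row_base D.
have CD : (C <= D)%MS by rewrite (submx_trans (submxMl _ _))// eq_row_base.
exists C; first by rewrite (submx_trans CD)// diffmxSl.
have rC : \rank C = d.
  rewrite mxrankMfree ?row_base_free// rank_pid_mx//.
have AC : (A :&: C)%MS = 0.
  by apply/eqP; rewrite -submx0 -(capmx_diff B A) capmxC capmxS.
rewrite /row_free -addsmxE mxrank_disjoint_sum// rC.
by move: Afree; rewrite /row_free => /eqP->.
Qed.

Lemma complete_kernel_basis (K : fieldType) (M : 'M[K]_6) (p : 'rV[K]_6) :
  (\rank M <= 2)%N -> p != 0 -> p *m M = 0 ->
  exists h : 'M[K]_6, [/\ h \in unitmx, row 0 h = p &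
    forall a : 'I_6, (a < 4)%N -> row a h *m M = 0].
Proof.
move=> M2 p0 pM; have pk : (p <= kermx M)%MS by apply/sub_kermxP.
have pfree : row_free p by rewrite /row_free rank_rV p0.
have [|A Ak pA] := row_free_extend (d := 3) pfree pk.
  by rewrite mxrank_ker -[6%N]/(4 + 2)%N -addnBA// leq_addr.
have [|C _ pAC] := row_free_extend (d := 2) pA (submx1 _); first by rewrite mxrank1.
pose h : 'M[K]_6 := col_mx (col_mx p A) C.
have kP : (col_mx p A <= kermx M)%MS by rewrite col_mx_sub pk.
have lowE (b : 'I_(1 + 3)) : row (lshift 2 b) h = row b (col_mx p A).
  by apply/rowP => j; rewrite !mxE (unsplitK (inl b)) mxE.
exists h; split; first by rewrite -row_free_unit.
  have -> : (0 : 'I_6) = lshift 2 (lshift 3 (0 : 'I_1)) by apply: val_inj.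
  rewrite lowE; apply/rowP => j; rewrite mxE.
  by rewrite col_mxEu.
move=> a a4; have -> : a = lshift 2 (Ordinal a4 : 'I_(1 + 3)) by apply: val_inj.
by rewrite lowE; apply/sub_kermxP; apply: submx_trans kP; apply: row_sub.
Qed.

(** * Cubic forms as symmetric trilinear forms *)

Module TrilinearForms.
Import mpoly.

Definition triple : predArgType := ('I_6 * 'I_6 * 'I_6)%type.

Definition triple_mnm (t : triple) : 'X_{1..6} :=
  (U_(t.1.1) + U_(t.1.2) + U_(t.2))%MM.

Definition triple_count (m : 'X_{1..6}) : nat :=
  #|[set t : triple | triple_mnm t == m]|.

Lemma mdeg_triple_mnm t : mdeg (triple_mnm t) = 3.
Proof. by rewrite /triple_mnm !mdegD !mdeg1. Qed.

Lemma mdegS_split k (m : 'X_{1..6}) : mdeg m = k.+1 ->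
  exists i m', mdeg m' = k /\ m = (U_(i) + m')%MM.
Proof.
move=> mk; have [i mi] : exists i, m i != 0%N.
  apply/existsP; rewrite -negb_forall; apply/negP => /forallP m0.
  suff m00 : m = 0%MM by move: mk; rewrite m00 mdeg0.
  by apply/mnmP => i; rewrite mnm0E (eqP (m0 i)).
have mE : m = (U_(i) + (m - U_(i)))%MM.
  by rewrite addmC submK// lep1mP.
exists i, (m - U_(i))%MM; split => //.
by move: mk; rewrite {1}mE mdegD mdeg1 => -[].
Qed.

Lemma mdeg3_triple (m : 'X_{1..6}) : mdeg m = 3 -> exists t, m = triple_mnm t.
Proof.
move=> /mdegS_split[i [m1 [/mdegS_split[j [m2 [/mdegS_split[k [m3]]]]]]]].
move=> [/eqP]; rewrite mdeg_eq0 => /eqP-> -> -> ->.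
by exists (i, j, k); rewrite /triple_mnm/= addm0 addmA.
Qed.

Section Trilinear.
Variable K : numFieldType.
Implicit Types (F G : {mpoly K[6]}) (x y z p : 'rV[K]_6).

Definition ev F x : K := F.@[fun j => x 0 j].

(* The coefficients of the symmetric trilinear form whose restriction to the
   diagonal is the cubic form [F]. *)
Definition tri_coef F (t : triple) : K :=
  F@_(triple_mnm t) / (triple_count (triple_mnm t))%:R.

Definition tri F x y z : K :=
  \sum_(t : triple) tri_coef F t * (x 0 t.1.1 * y 0 t.1.2 * z 0 t.2).

Lemma triple_count_neq0 t : (triple_count (triple_mnm t))%:R != 0 :> K.
Proof.
rewrite pnatr_eq0 -lt0n; apply/card_gt0P; exists t; by rewrite inE.
Qed.

Lemma tri_coef_eq0 F t : (tri_coef F t == 0) = (F@_(triple_mnm t) == 0).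
Proof. by rewrite mulf_eq0 invr_eq0 (negPf (triple_count_neq0 t)) orbF. Qed.

Lemma homog_tripleE F : F \is 3.-homog ->
  F = \sum_(t : triple) tri_coef F t *: 'X_[triple_mnm t].
Proof.
move=> F3; apply/mpolyP => m; rewrite raddf_sum/=.
under eq_bigr do rewrite mcoeffZ mcoeffX.
have [m3|m3] := eqVneq (mdeg m) 3%N; last first.
  rewrite (dhomog_nemf_coeff F3 m3) big1// => t _.
  case: eqP => [tm|_]; last by rewrite mulr0.
  by move: m3; rewrite -tm mdeg_triple_mnm.
have [t0 mE] := mdeg3_triple m3.
rewrite (eq_bigr (fun t => if triple_mnm t == m then
    F@_m / (triple_count m)%:R else 0)); last first.
  by move=> t _; rewrite /tri_coef; case: eqP => [->|_]; rewrite ?mulr1 ?mulr0.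
rewrite -big_mkcond sumr_const/= -[RHS]mulr_natr.
have -> : #|[pred t | triple_mnm t == m]| = triple_count m.
  by apply: eq_card => t; rewrite !inE.
by rewrite mulfVK// mE triple_count_neq0.
Qed.

Lemma tri_diag F x : F \is 3.-homog -> ev F x = tri F x x x.
Proof.
move=> /homog_tripleE {1}->; rewrite /ev raddf_sum/=; apply: eq_bigr => t _.
by rewrite mevalZ /triple_mnm !mpolyXD !mevalM !mevalXU.
Qed.

Lemma triDl F x x' y z : tri F (x + x') y z = tri F x y z + tri F x' y z.
Proof. by rewrite -big_split/=; apply: eq_bigr => t _; rewrite mxE; ring. Qed.

Lemma triZl F a x y z : tri F (a *: x) y z = a * tri F x y z.
Proof. by rewrite mulr_sumr; apply: eq_bigr => t _; rewrite mxE; ring. Qed.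

Lemma triC12 F x y z : tri F x y z = tri F y x z.
Proof.
pose s (t : triple) : triple := (t.1.2, t.1.1, t.2).
have sK : involutive s by case=> [[i j] k].
rewrite /tri (reindex_inj (inv_inj sK)); apply: eq_bigr => -[[i j] k] _ /=.
rewrite /tri_coef; have -> : triple_mnm (s (i, j, k)) = triple_mnm (i, j, k).
  by rewrite /triple_mnm/= [(U_(j) + _)%MM]addmC.
by ring.
Qed.

Lemma triC23 F x y z : tri F x y z = tri F x z y.
Proof.
pose s (t : triple) : triple := (t.1.1, t.2, t.1.2).
have sK : involutive s by case=> [[i j] k].
rewrite /tri (reindex_inj (inv_inj sK)); apply: eq_bigr => -[[i j] k] _ /=.
rewrite /tri_coef; have -> : triple_mnm (s (i, j, k)) = triple_mnm (i, j, k).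
  by rewrite /triple_mnm/= -!addmA [(U_(k) + _)%MM]addmC.
by ring.
Qed.

Lemma triDm F x y y' z : tri F x (y + y') z = tri F x y z + tri F x y' z.
Proof. by rewrite triC12 triDl !(triC12 _ x). Qed.

Lemma triDr F x y z z' : tri F x y (z + z') = tri F x y z + tri F x y z'.
Proof. by rewrite triC23 triDm !(triC23 _ x y). Qed.

Lemma triZm F a x y z : tri F x (a *: y) z = a * tri F x y z.
Proof. by rewrite triC12 triZl triC12. Qed.

Lemma triZr F a x y z : tri F x y (a *: z) = a * tri F x y z.
Proof. by rewrite triC23 triZm triC23. Qed.

Lemma tri_delta F i j k :
  tri F (delta_mx 0 i) (delta_mx 0 j) (delta_mx 0 k) = tri_coef F (i, j, k).
Proof.
rewrite /tri (bigD1 (i, j, k))//= !mxE !eqxx !mulr1 big1 ?addr0//.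
move=> -[[i' j'] k'] /=; rewrite !mxE !eqxx/= !xpair_eqE.
by case: (i' == i); case: (j' == j); case: (k' == k); rewrite ?(mulr0, mul0r).
Qed.

Lemma tri_polarization F x y z : F \is 3.-homog ->
  6 * tri F x y z = ev F (x + y + z) - ev F (x + y) - ev F (x + z)
    - ev F (y + z) + ev F x + ev F y + ev F z.
Proof.
move=> F3; rewrite !(tri_diag _ F3) !triDl !triDm !triDr.
have sq a b : tri F a b a = tri F a a b by rewrite triC23.
have sq' a b : tri F b a a = tri F a a b by rewrite triC12 triC23.
rewrite (sq x y) (sq' x y) (sq x z) (sq' x z) (sq y x) (sq' y x) (sq y z).
rewrite (sq' y z) (sq z x) (sq' z x) (sq z y) (sq' z y).
rewrite (triC12 F z x y) (triC12 F y x z) (triC12 F z y x).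
rewrite (triC23 F y z x) (triC12 F y x z) (triC23 F x z y).
by ring.
Qed.

Lemma tri_mderiv F p (i : 'I_6) : F \is 3.-homog ->
  (F^`M(i)).@[fun j => p 0 j] = 3 * tri F p p (delta_mx 0 i).
Proof.
move=> F3; have -> : 3 * tri F p p (delta_mx 0 i) = tri F (delta_mx 0 i) p p
    + tri F p (delta_mx 0 i) p + tri F p p (delta_mx 0 i).
  by rewrite triC12 (triC23 F p (delta_mx 0 i)); ring.
rewrite {1}(homog_tripleE F3) (raddf_sum (mderiv i)) (raddf_sum (meval _)) -!big_split.
apply: eq_bigr => t _.
have dX k : (('X_k : {mpoly K[6]})^`M(i)).@[fun j => p 0 j] = (k == i)%:R.
  rewrite mderivX mnm1E mevalZ; case: eqP => [->|_]; last by rewrite mul0r.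
  have -> : (U_(i) - U_(i))%MM = 0%MM :> 'X_{1..6}.
    by apply/mnmP => j; rewrite mnmBE subnn mnm0E.
  by rewrite mpolyX0 meval1 mulr1.
rewrite -[LHS]/((tri_coef F t *: 'X_[triple_mnm t])^`M(i)).@[fun j => p 0 j].
rewrite mderivZ mevalZ /triple_mnm !mpolyXD !mderivM !mevalD !mevalM.
rewrite !mevalD !mevalM !dX !mevalXU !mxE !eqxx/=.
by ring.
Qed.

Lemma singular_tri F p : F \is 3.-homog -> singular_point F p ->
  forall z, tri F p p z = 0.
Proof.
move=> F3 [_ _ dF] z; rewrite (row_sum_delta z); elim/big_ind: _.
- by rewrite -[0](scale0r 0) triZr mul0r.
- by move=> a b a0 b0; rewrite triDr a0 b0 addr0.
move=> i _; rewrite triZr; have := dF i; rewrite (tri_mderiv _ _ F3).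
by move/eqP; rewrite mulf_eq0 pnatr_eq0/= => /eqP->; rewrite mulr0.
Qed.

Lemma linsubst_ev g F x : ev (linsubst g F) x = ev F (x *m g^T).
Proof.
rewrite /ev /linsubst comp_mpoly_meval; apply: meval_eq => i.
rewrite tnth_mktuple raddf_sum mxE; apply: eq_bigr => j _ /=.
by rewrite mevalZ mevalXU mxE mulrC.
Qed.

Lemma linsubst_homog g F : F \is 3.-homog -> linsubst g F \is 3.-homog.
Proof.
move=> /homog_tripleE ->; rewrite /linsubst raddf_sum/=; apply: rpred_sum => t _.
rewrite comp_mpolyZ; apply: dhomogZ.
have lin i : (\sum_(j < 6) g i j *: 'X_j : {mpoly K[6]}) \is 1.-homog.
  by apply: rpred_sum => j _; apply: dhomogZ; rewrite dhomogX/= mdeg1.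
rewrite /triple_mnm !mpolyXD !rmorphM/= !comp_mpolyXU -!tnth_nth !tnth_mktuple.
by apply: (@dhomogM _ _ _ 2 _ 1) => //; apply: (@dhomogM _ _ _ 1 _ 1).
Qed.

Lemma linsubst_tri g F x y z : F \is 3.-homog ->
  tri (linsubst g F) x y z = tri F (x *m g^T) (y *m g^T) (z *m g^T).
Proof.
move=> F3; have n6 : 6 != 0 :> K by rewrite pnatr_eq0.
apply: (mulfI n6); rewrite !tri_polarization ?linsubst_homog// !linsubst_ev.
by rewrite !mulmxDl.
Qed.

Lemma S6_weight_tripleE (t : triple) : S6_weight (triple_mnm t) =
  S6_weights`_(t.1.1) + S6_weights`_(t.1.2) + S6_weights`_(t.2).
Proof.
have wU i : S6_weight U_(i) = S6_weights`_i.
  rewrite /S6_weight (bigD1 i)//= big1 ?addr0 => [|j ji].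
    by rewrite mnm1E eqxx mul1r.
  by rewrite mnm1E eq_sym (negPf ji) mul0r.
have wD m m' : S6_weight (m + m')%MM = S6_weight m + S6_weight m'.
  by rewrite -big_split/=; apply: eq_bigr => j _; rewrite mnmDE PoszD mulrDl.
by rewrite /triple_mnm !wD !wU.
Qed.

Lemma S6_weight_triple (t : triple) : 0 < S6_weight (triple_mnm t) ->
  [|| (t.1.1 == 0) && ((t.1.2 < 4)%N || (t.2 < 4)%N),
      (t.1.2 == 0) && ((t.1.1 < 4)%N || (t.2 < 4)%N)
    | (t.2 == 0) && ((t.1.1 < 4)%N || (t.1.2 < 4)%N)].
Proof.
rewrite S6_weight_tripleE; case: t => [[i j] k] /=.
by case: i => [[|[|[|[|[|[|i]]]]]] ?]; case: j => [[|[|[|[|[|[|j]]]]]] ?];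
  case: k => [[|[|[|[|[|[|k]]]]]] ?].
Qed.

Lemma type_S6_of_kernel F p :
  F \is 3.-homog -> p != 0 -> (forall z, tri F p p z = 0) ->
  (\rank (\matrix_(i, j) tri F p (delta_mx 0 i) (delta_mx 0 j))%R <= 2)%N ->
  type_S6 F.
Proof.
move=> F3 p0 ppz; set M := (\matrix_(_, _) _)%R => M2.
have triM x j : tri F p x (delta_mx 0 j) = (x *m M) 0 j.
  rewrite mxE {1}(row_sum_delta x); elim/big_ind2: _ => [|a b c d ab cd|k _].
  - by rewrite -[0 in LHS](scale0r 0) triZm mul0r.
  - by rewrite triDm ab cd.
  - by rewrite triZm mxE.
have ker_tri x : x *m M = 0 -> forall y, tri F p x y = 0.
  move=> xM y; rewrite (row_sum_delta y); elim/big_ind: _ => [|a b a0 b0|j _].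
  - by rewrite -[0 in LHS](scale0r 0) triZr mul0r.
  - by rewrite triDr a0 b0 addr0.
  - by rewrite triZr triM xM mxE mulr0.
have pM : p *m M = 0 by apply/rowP => j; rewrite -triM ppz mxE.
have [h [hU h0 hker]] := complete_kernel_basis M2 p0 pM.
exists h^T => [|m]; first by rewrite unitmx_tr.
have G3 := linsubst_homog h^T F3.
rewrite mcoeff_msupp => Gm.
have [t mE] : exists t, m = triple_mnm t.
  apply: mdeg3_triple; apply/eqP; apply: contraNT Gm => m3.
  by rewrite (dhomog_nemf_coeff G3).
rewrite leNgt; apply: contraNN Gm; rewrite mE -tri_coef_eq0.
case: t {mE} => [[a b] c] /S6_weight_triple /= abc.
rewrite -tri_delta linsubst_tri// trmxK -!rowE.
have killed (a' b' : 'I_6) z : a' == 0 -> (b' < 4)%N -> tri F (row a' h) (row b' h) z = 0.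
  by move=> /eqP-> b4; rewrite h0; apply: ker_tri; apply: hker.
apply/eqP; case/or3P: abc => /andP[e0 /orP[]] lt4.
- exact: killed.
- by rewrite triC23; apply: killed.
- by rewrite triC12; apply: killed.
- by rewrite triC12 triC23; apply: killed.
- by rewrite triC23 triC12; apply: killed.
- by rewrite triC12 triC23 triC12; apply: killed.
Qed.

Definition affine_direction n (i : 'I_n.+1) (v : 'rV[K]_n) : 'rV[K]_n.+1 :=
  \row_j (if unlift i j is Some k then v 0 k else 0).

Lemma local_equation_second_difference F i (y v : 'rV[K]_5) (t : K) :
  F \is 3.-homog ->
  local_equation F i (y + t *: v) + local_equation F i (y - t *: v)
    - 2 * local_equation F i y
  = 2 * t ^+ 2 * (3 * tri F (affine_chart i y) (affine_direction i v)
      (affine_direction i v)).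
Proof.
move=> F3; set p := affine_chart i y; set d := affine_direction i v.
have chartE s : affine_chart i (y + s *: v) = p + s *: d.
  apply/rowP => j; rewrite !mxE; case: unliftP => [k _|_]; rewrite ?mxE //.
  by rewrite mulr0 addr0.
rewrite -scaleNr -![local_equation F i _]/(ev F (affine_chart i _)) !chartE -/p.
rewrite !(tri_diag _ F3) !(triDl, triDm, triDr) !(triZl, triZm, triZr).
rewrite (triC23 F p d p) (triC12 F d p p) (triC23 F p d p).
rewrite (triC12 F d p d) (triC23 F d d p) (triC12 F d p d).
by ring.
Qed.

Lemma singular_type_S6 F i (y : 'rV[K]_5) :
  F \is 3.-homog -> singular_point F (affine_chart i y) ->
  (forall e : K, 0 < e -> exists (u0 : K) (l l' : 'I_5 -> K),
     forall v : 'rV[K]_5, (forall j, `|v 0 j| <= 1) ->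
     `|3 * tri F (affine_chart i y) (affine_direction i v) (affine_direction i v)
       - u0 * ((\sum_k l k * v 0 k) ^+ 2 + (\sum_k l' k * v 0 k) ^+ 2)| <= e) ->
  type_S6 F.
Proof.
move=> F3 Fp; set p := affine_chart i y => approx.
have p0 : p != 0 by have [] := Fp.
have ppz := singular_tri F3 Fp.
apply: (type_S6_of_kernel F3 p0 ppz).
pose x (j : 'I_6) : 'rV[K]_5 :=
  \row_k ((delta_mx 0 j - (i == j)%:R *: p : 'rV[K]_6) 0 (lift i k)).
have dirE j : affine_direction i (x j) = delta_mx 0 j - (i == j)%:R *: p.
  apply/rowP => k; rewrite [LHS]mxE; case: unliftP => [k' ->|->]; first by rewrite mxE.
  by rewrite !mxE unlift_none eqxx mulr1 subrr.
have dirD v w : affine_direction i (v + w) = affine_direction i v + affine_direction i w.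
  apply/rowP => k; rewrite !mxE; case: unlift => [k'|]; rewrite ?mxE//.
  by rewrite addr0.
have dirZ t v : affine_direction i (t *: v) = t *: affine_direction i v.
  apply/rowP => k; rewrite !mxE; case: unlift => [k'|]; rewrite ?mxE//.
  by rewrite mulr0.
pose q v := 3 * tri F p (affine_direction i v) (affine_direction i v).
have qZ t v : q (t *: v) = t ^+ 2 * q v.
  by rewrite /q dirZ triZm triZr; ring.
have := rank_polarization x qZ approx.
have -> : (\matrix_(j, k) (q (x j + x k) - q (x j) - q (x k)))%R =
  6 *: (\matrix_(j, k) tri F p (delta_mx 0 j) (delta_mx 0 k))%R.
  apply/matrixP => j k; rewrite !mxE /q !dirD !triDm !triDr.
  rewrite (triC23 F p (affine_direction i (x k)) (affine_direction i (x j))) !dirE.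
  have triBp z w s : tri F p (z - s *: p) w = tri F p z w.
    by rewrite triDm -scaleNr triZm triC23 ppz mulr0 addr0.
  have triBp' z w s : tri F p z (w - s *: p) = tri F p z w.
    by rewrite triC23 triBp triC23.
  by rewrite !triBp !triBp'; ring.
by rewrite mxrank_scale_nz// pnatr_eq0.
Qed.

End Trilinear.
End TrilinearForms.

(** * Forms of type S6 are not properly stable *)

From mathcomp Require Import finmap boolp classical_sets cardinality.

Module Unstable.
Import mpoly TrilinearForms.
Local Open Scope classical_set_scope.

Section Unstable.
Variable K : numClosedFieldType.
Implicit Types (F G : {mpoly K[6]}) (g : 'M[K]_6).

Lemma homog_ev_inj F G : F \is 3.-homog -> G \is 3.-homog ->
  ev F =1 ev G -> F = G.
Proof.
move=> F3 G3 FG; have n6 : 6 != 0 :> K by rewrite pnatr_eq0.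
rewrite (homog_tripleE F3) (homog_tripleE G3); apply: eq_bigr => -[[i j] k] _.
by rewrite -!tri_delta; congr (_ *: _); apply: (mulfI n6); rewrite !tri_polarization// !FG.
Qed.

Lemma linsubst_comp g g' F : F \is 3.-homog ->
  linsubst g (linsubst g' F) = linsubst (g' *m g) F.
Proof.
move=> F3; apply: homog_ev_inj; rewrite ?linsubst_homog// => x.
by rewrite !linsubst_ev trmx_mul mulmxA.
Qed.

Lemma evZ k F x : ev (k *: F) x = k * ev F x.
Proof. exact: mevalZ. Qed.

Lemma linsubst_scale k g F : F \is 3.-homog ->
  linsubst (k *: g) F = k ^+ 3 *: linsubst g F.
Proof.
move=> F3; apply: homog_ev_inj; rewrite ?dhomogZ ?linsubst_homog// => x.
rewrite evZ !linsubst_ev linearZ/= -scalemxAr !tri_diag//.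
by rewrite triZl triZm triZr; ring.
Qed.

Lemma type_S6_SL F : F \is 3.-homog -> type_S6 F ->
  exists2 g, \det g = 1 &
    forall m : 'X_{1..6}, m \in msupp (linsubst g F) -> S6_weight m <= 0.
Proof.
move=> F3 [g gU gw]; have dg : \det g != 0 by rewrite -unitfE -unitmxE.
pose k := 6.-root (\det g)^-1.
have k6 : k ^+ 6 = (\det g)^-1 by rewrite rootCK.
exists (k *: g); first by rewrite detZ k6 mulVf.
move=> m; rewrite linsubst_scale// mcoeff_msupp mcoeffZ mulf_eq0 negb_or.
by move=> /andP[_ mg]; apply: gw; rewrite mcoeff_msupp.
Qed.

Definition one_param (s : K) : 'M[K]_6 :=
  diag_mx (\row_i s ^ (- S6_weights`_i)).

Lemma det_one_param s : s != 0 -> \det (one_param s) = 1.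
Proof.
move=> s0; rewrite det_diag !big_ord_recl big_ord0 !mxE mulr1 /=.
by rewrite -!expfzDr.
Qed.

Lemma delta_one_param s (i : 'I_6) :
  delta_mx 0 i *m (one_param s)^T = s ^ (- S6_weights`_i) *: delta_mx 0 i :> 'rV_6.
Proof.
rewrite tr_diag_mx -rowE row_diag_mx mxE.
by [].
Qed.

Lemma mcoeff_one_param G s m : G \is 3.-homog -> s != 0 ->
  (forall m, m \in msupp G -> S6_weight m <= 0) ->
  (linsubst (one_param s) G)@_m = G@_m * s ^+ `|S6_weight m|%N.
Proof.
move=> G3 s0 Gw.
have [m3|m3] := eqVneq (mdeg m) 3%N; last first.
  by rewrite !(dhomog_nemf_coeff _ m3) ?mul0r ?linsubst_homog.
have [t mE] := mdeg3_triple m3.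
have coefE (H : {mpoly K[6]}) : H@_m = tri_coef H t * (triple_count m)%:R.
  by rewrite /tri_coef -mE mulfVK// mE triple_count_neq0.
rewrite (coefE G) (coefE (linsubst _ _)) [RHS]mulrAC; congr (_ * _).
have [Gt|Gt] := eqVneq (tri_coef G t) 0.
  rewrite Gt mul0r; move: Gt; case: t {mE coefE} => [[i j] k].
  rewrite -!tri_delta linsubst_tri// !delta_one_param triZl triZm triZr => ->.
  by rewrite !mulr0.
have w0 : S6_weight m <= 0.
  by apply: Gw; rewrite mcoeff_msupp coefE mulf_neq0// mE triple_count_neq0.
have -> : s ^+ `|S6_weight m|%N = s ^ (- S6_weight m).
  by rewrite -abszN -[LHS]/(s ^ (`|- S6_weight m|%N : int)) gez0_abs// oppr_ge0.
rewrite mE S6_weight_tripleE; case: t {mE coefE w0 Gt} => [[i j] k] /=.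
rewrite -!tri_delta linsubst_tri// !delta_one_param triZl triZm triZr.
by rewrite !opprD !expfzDr//; ring.
Qed.

Definition weight_scaling G (s : K) : {mpoly K[6]} :=
  \sum_(m <- msupp G) (G@_m * s ^+ `|S6_weight m|%N) *: 'X_[m].

Lemma mcoeff_weight_scaling G s m :
  (weight_scaling G s)@_m = G@_m * s ^+ `|S6_weight m|%N.
Proof.
rewrite /weight_scaling raddf_sum/=.
under eq_bigr do rewrite mcoeffZ mcoeffX.
have [Gm|Gm] := boolP (m \in msupp G).
  rewrite (bigD1_seq m)//= eqxx mulr1 big1 ?addr0// => m' /negPf->.
  by rewrite mulr0.
rewrite [G@_m]memN_msupp_eq0// mul0r big_seq big1// => m' Gm'.
by case: eqP Gm => [<-|_ _]; rewrite ?Gm'// mulr0.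
Qed.

Lemma weight_scaling_homog G s : G \is 3.-homog -> weight_scaling G s \is 3.-homog.
Proof.
move=> /dhomogP G3; rewrite /weight_scaling big_seq; apply: rpred_sum => m Gm.
by apply: dhomogZ; rewrite dhomogX; apply/eqP/G3.
Qed.

Lemma weight_scalingE G s : G \is 3.-homog -> s != 0 ->
  (forall m, m \in msupp G -> S6_weight m <= 0) ->
  weight_scaling G s = linsubst (one_param s) G.
Proof.
move=> G3 s0 Gw; apply/mpolyP => m.
by rewrite mcoeff_weight_scaling mcoeff_one_param.
Qed.

Lemma eq_horner_of_punctured (p : {poly K}) c :
  (forall s, s != 0 -> p.[s] = c) -> p.[0] = c.
Proof.
move=> pc; suff /eqP : p - c%:P == 0.
  move/(congr1 (horner^~ 0)); rewrite hornerD hornerN hornerC horner0.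
  by move=> /eqP; rewrite subr_eq0 => /eqP.
apply/negPn/negP => q0.
pose rs : seq K := [seq i.+1%:R | i <- iota 0 (size (p - c%:P)%R)].
have := max_poly_roots (rs := rs) q0; rewrite size_map size_iota ltnn => H.
suff : false by []; apply: H.
  apply/allP => _ /mapP[i _ ->]; rewrite /root hornerD hornerN hornerC pc ?subrr//.
  by rewrite pnatr_eq0.
by rewrite map_inj_uniq ?iota_uniq// => i j /eqP; rewrite eqr_nat eqSS => /eqP.
Qed.

Lemma eval_weight_scaling_limit (P : {mpoly K[#|cubic_monomials|]}) G c :
  (forall s, s != 0 -> eval_at_form P (weight_scaling G s) = c) ->
  eval_at_form P (weight_scaling G 0) = c.
Proof.
pose p : {poly K} := \sum_(m <- msupp P) P@_m *:
  \prod_k (cubic_coefs G k *: 'X^`|S6_weight (bmnm (enum_val k))|%N) ^+ m k.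
have pE s : eval_at_form P (weight_scaling G s) = p.[s].
  rewrite /eval_at_form mevalE /p horner_sum; apply: eq_bigr => m _.
  rewrite hornerZ horner_prod; congr (_ * _); apply: eq_bigr => k _.
  by rewrite horner_exp hornerZ hornerXn /cubic_coefs mcoeff_weight_scaling.
by move=> Pc; rewrite pE; apply: eq_horner_of_punctured => s /Pc; rewrite pE.
Qed.

Lemma eval_at_form0 d (P : {mpoly K[#|cubic_monomials|]}) :
  (0 < d)%N -> P \is d.-homog -> eval_at_form P 0 = 0.
Proof.
move=> d0 /dhomogP Pd; rewrite /eval_at_form mevalE big_seq big1// => m /Pd md.
have [k mk] : exists k, m k != 0%N.
  apply/existsP; rewrite -negb_forall; apply/negP => /forallP m0.
  suff m00 : m = 0%MM by move: d0; rewrite -md m00 /= mdeg0.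
  by apply/mnmP => i; rewrite mnm0E (eqP (m0 i)).
by rewrite (bigD1 k)//= /cubic_coefs mcoeff0 expr0n (negPf mk) mul0r mulr0.
Qed.

Lemma type_S6_not_properly_stable F :
  cubic_form F -> type_S6 F -> ~ properly_stable F.
Proof.
move=> [F0 F3] /(type_S6_SL F3)[g dg gw] [[d [I [d0 Id Iinv [_ IF] Iclosed]]] finF].
have [E [_ EP]] := Iclosed F (conj (conj F0 F3) IF).
set G := linsubst g F in gw; have G3 : G \is 3.-homog by apply: linsubst_homog.
pose D := weight_scaling G.
have DE s : s != 0 -> D s = linsubst (g *m one_param s) F.
  by move=> s0; rewrite /D weight_scalingE// linsubst_comp.
have det_gs s : s != 0 -> \det (g *m one_param s) = 1.
  by move=> s0; rewrite det_mulmx dg det_one_param// mulr1.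
have ID s : s != 0 -> eval_at_form I (D s) = eval_at_form I F.
  by move=> s0; rewrite DE// Iinv// det_gs.
have ID0 := eval_weight_scaling_limit ID; rewrite -/(D 0) in ID0.
have D3 s : D s \is 3.-homog by apply: weight_scaling_homog.
have nonvanishing s : eval_at_form I (D s) = eval_at_form I F ->
    nonvanishing_locus I (D s).
  move=> IDs; split; last by rewrite IDs.
  split => //; apply: contraNneq IF => Ds0.
  by rewrite -IDs Ds0 (eval_at_form0 d0 Id).
have orbitD s : s != 0 -> same_orbit F (D s).
  move=> s0; exists (g *m one_param s), 1; split; rewrite ?det_gs ?oner_eq0//.
  by rewrite scale1r DE.
have [h [c [dh c0 D0E]]] : same_orbit F (D 0).
  apply/(EP _ (nonvanishing _ ID0)) => Q EQ; apply: eval_weight_scaling_limit => s s0.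
  by have /(EP _ (nonvanishing _ (ID s s0)))/(_ Q EQ) := orbitD s s0.
have hU : h \in unitmx by rewrite unitmxE dh unitr1.
have D0w m : m \in msupp (D 0) -> S6_weight m = 0.
  rewrite mcoeff_msupp mcoeff_weight_scaling mulf_eq0 negb_or expr0n => /andP[_].
  by rewrite pnatr_eq0 eqb0 negbK absz_eq0 => /eqP.
have D0fix s : s != 0 -> linsubst (one_param s) (D 0) = D 0.
  move=> s0; apply/mpolyP => m; rewrite mcoeff_one_param// => [|m' /D0w->//].
  have [/D0w->|m0] := boolP (m \in msupp (D 0)); first by rewrite mulr1.
  by rewrite memN_msupp_eq0// mul0r.
have fixF s : s != 0 -> linsubst (h *m one_param s *m invmx h) F = F.
  move=> s0; apply: homog_ev_inj; rewrite ?linsubst_homog// => x.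
  have cev z : c * ev F (z *m h^T) = ev (D 0) z by rewrite D0E evZ linsubst_ev.
  apply: (mulfI c0); rewrite linsubst_ev !trmx_mul !mulmxA cev.
  rewrite -linsubst_ev D0fix// -cev.
  by rewrite -mulmxA -trmx_mul mulmxV// trmx1 mulmx1.
pose f (n : nat) := h *m one_param n.+1%:R *m invmx h.
apply: infinite_nat; have -> : [set: nat] = f @^-1` projective_stabiliser F.
  apply/esym/seteqP; split => // n _; split.
    rewrite /f !det_mulmx det_one_param ?pnatr_eq0// mulr1 -det_mulmx mulmxV//.
    exact: det1.
  exists 1; rewrite ?oner_eq0// scale1r; apply: fixF.
  by rewrite pnatr_eq0.
apply: finite_preimage finF => n n' _ _ /(congr1 (fun A => invmx h *m A *m h)).
rewrite /f !mulmxA mulVmx// !mul1mx -!mulmxA mulVmx// !mulmx1.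
move=> /matrixP/(_ (inord 5) (inord 5)); rewrite !mxE !eqxx !inordK// !mulr1n /=.
rewrite !expr1z => /eqP; rewrite eqr_nat eqSS => /eqP.
by [].
Qed.

End Unstable.
End Unstable.

(** * Convergent power series and germs of class E6~ *)

Module PowerSeries.
Import topology normedtype summability.
Import numFieldNormedType.Exports.
Local Open Scope classical_set_scope.

Section PowerSeries.
Variable K : numFieldType.
#[local] Existing Instance totally_filter.

Definition entries_le n (r : K) (v : 'rV[K]_n) := forall j, `|v 0 j| <= r.

Definition total_degree n (m : {ffun 'I_n -> nat}) : nat := (\sum_i m i)%N.

Lemma monomial_ind n (P : nat -> ('rV[K]_n -> K) -> Prop) :
  P 0%N (fun=> 1) ->
  (forall i k g, P k g -> P k.+1 (fun v => v 0 i * g v)) ->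
  forall m, P (total_degree m) (monomial_at m).
Proof.
move=> P0 PS m.
have -> : @monomial_at K n m = fun v => \prod_(i <- index_enum 'I_n) v 0 i ^+ m i.
  by apply: funext.
rewrite /total_degree; elim: (index_enum _) => [|i s IHs].
  rewrite big_nil; suff -> : (fun v : 'rV[K]_n => \prod_(i <- [::]) v 0 i ^+ m i)
    = fun=> 1 by [].
  by apply: funext => v; rewrite big_nil.
have -> : (fun v : 'rV[K]_n => \prod_(j <- i :: s) v 0 j ^+ m j) =
    fun v => v 0 i ^+ m i * \prod_(j <- s) v 0 j ^+ m j.
  by apply: funext => v; rewrite big_cons.
rewrite big_cons; elim: (m i) => [|k IHk].
  suff -> : (fun v : 'rV[K]_n => v 0 i ^+ 0 * \prod_(j <- s) v 0 j ^+ m j) =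
    fun v => \prod_(j <- s) v 0 j ^+ m j by [].
  by apply: funext => v; rewrite mul1r.
rewrite addSn; suff -> : (fun v : 'rV[K]_n =>
    v 0 i ^+ k.+1 * \prod_(j <- s) v 0 j ^+ m j) =
  fun v => v 0 i * (v 0 i ^+ k * \prod_(j <- s) v 0 j ^+ m j) by exact: PS.
by apply: funext => v; rewrite exprS mulrA.
Qed.

Definition second_difference n (f : 'rV[K]_n -> K) (w h : 'rV[K]_n) : K :=
  f (w + h) + f (w - h) - 2 * f w.

Lemma norm_mul_le (x y a b : K) : `|x| <= a -> `|y| <= b -> `|x * y| <= a * b.
Proof. by move=> xa yb; rewrite normrM ler_pM. Qed.

Lemma norm_add_le (x y a b : K) : `|x| <= a -> `|y| <= b -> `|x + y| <= a + b.
Proof. by move=> xa yb; rewrite (le_trans (ler_normD _ _))// lerD. Qed.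

Lemma monomial_second_difference n (m : {ffun 'I_n -> nat}) (rho a b : K)
    (d h : 'rV[K]_n) : 0 <= rho -> 0 <= a <= 1 -> 0 <= b <= 1 ->
  entries_le (a * rho) d -> entries_le (b * rho) h ->
  `|second_difference (monomial_at m) d h
    - second_difference (monomial_at m) 0 h|
  <= 2 * a * b ^+ 2 * (2 * rho) ^+ total_degree m.
Proof.
move=> rho0 /andP[a0 a1] /andP[b0 b1] da hb.
(* These bounds are jointly stable under multiplying [g] by a coordinate. *)
pose P k (g : 'rV[K]_n -> K) :=
  [/\ `|g (d + h)| <= (2 * rho) ^+ k, `|g (d - h)| <= (2 * rho) ^+ k,
      `|g (d + h) - g h| <= a * (2 * rho) ^+ k
    & `|g (d - h) - g (- h)| <= a * (2 * rho) ^+ k] /\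
  [/\ `|g (d + h) - g (d - h)| <= 2 * b * (2 * rho) ^+ k,
      `|(g (d + h) - g (d - h)) - (g h - g (- h))|
         <= 2 * a * b * (2 * rho) ^+ k,
      `|second_difference g d h| <= 2 * b ^+ 2 * (2 * rho) ^+ k &
      `|second_difference g d h - second_difference g 0 h|
         <= 2 * a * b ^+ 2 * (2 * rho) ^+ k].
suff [_ []] : P (total_degree m) (monomial_at m) by [].
have ar : a * rho <= rho by rewrite ler_piMl.
have br : b * rho <= rho by rewrite ler_piMl.
apply: (monomial_ind (P := P)) => [|i k g [[X Y XX0 YY0] [V VV0 D DD0]]].
  rewrite /P /second_difference expr0 !mulr1.
  have -> : 1 + 1 - 2 = 0 :> K by ring.
  by rewrite !subrr !normr0 normr1 !mulr_ge0// ?exprn_ge0.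
set t := (2 * rho) ^+ k in X Y XX0 YY0 V VV0 D DD0.
have t0 : 0 <= t by rewrite exprn_ge0// mulr_ge0.
have di := da i; have hi := hb i.
have dr := le_trans di ar; have hr := le_trans hi br.
rewrite /P /second_difference exprS -/t !mxE !add0r.
rewrite /second_difference !add0r in D DD0.
move: (d 0 i) (h 0 i) di hi dr hr X Y XX0 YY0 V VV0 D DD0 => x y {da hb} di hi dr hr.
move: (g (d + h)) (g (d - h)) (g h) (g (- h)) (g d) (g 0) => p q p0 q0 z z0.
move=> X Y XX0 YY0 V VV0 D DD0.
have W : `|p + q - p0 - q0| <= 2 * a * t.
  have -> : p + q - p0 - q0 = (p - p0) + (q - q0) by ring.
  by apply: le_trans (norm_add_le XX0 YY0) _; rewrite -mulrA mulr_natl.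
have le_sub (u e u' : K) : `|u| <= e -> u = u' \/ u = - u' -> `|u'| <= e.
  by move=> ue [<-//|e']; rewrite e' normrN in ue.
split; split.
- apply: le_trans (norm_mul_le (norm_add_le dr hr) X) _.
  by rewrite -mulr2n mulr_natl.
- rewrite -(normrN y) in hr.
  apply: le_trans (norm_mul_le (norm_add_le dr hr) Y) _.
  by rewrite -mulr2n mulr_natl.
- apply: le_trans (_ : a * rho * t + rho * (a * t) <= _).
    apply: (@le_sub (x * p + y * (p - p0))); last by left; ring.
    by apply: norm_add_le; apply: norm_mul_le.
  by rewrite le_eqVlt; apply/orP; left; apply/eqP; ring.
- apply: le_trans (_ : a * rho * t + rho * (a * t) <= _).
    rewrite -(normrN y) in hr.
    apply: (@le_sub (x * q + - y * (q - q0))); last by left; ring.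
    by apply: norm_add_le; apply: norm_mul_le.
  by rewrite le_eqVlt; apply/orP; left; apply/eqP; ring.
- apply: le_trans (_ : rho * (2 * b * t) + b * rho * (t + t) <= _).
    apply: (@le_sub (x * (p - q) + y * (p + q))); last by left; ring.
    apply: norm_add_le; apply: norm_mul_le => //.
    exact: norm_add_le.
  by rewrite le_eqVlt; apply/orP; left; apply/eqP; ring.
- apply: le_trans (_ : a * rho * (2 * b * t) + b * rho * (2 * a * t) <= _).
    apply: (@le_sub (x * (p - q) + y * (p + q - p0 - q0))); last by left; ring.
    by apply: norm_add_le; apply: norm_mul_le.
  by rewrite le_eqVlt; apply/orP; left; apply/eqP; ring.
- apply: le_trans (_ : rho * (2 * b ^+ 2 * t) + b * rho * (2 * b * t) <= _).
    apply: (@le_sub (x * (p + q - 2 * z) + y * (p - q))); last by left; ring.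
    by apply: norm_add_le; apply: norm_mul_le.
  by rewrite le_eqVlt; apply/orP; left; apply/eqP; ring.
- apply: le_trans (_ : a * rho * (2 * b ^+ 2 * t) + b * rho * (2 * a * b * t) <= _).
    apply: (@le_sub (x * (p + q - 2 * z) + y * (p - q - (p0 - q0)))); last by left; ring.
    by apply: norm_add_le; apply: norm_mul_le.
  by rewrite le_eqVlt; apply/orP; left; apply/eqP; ring.
Qed.

Lemma monomial_le n (m : {ffun 'I_n -> nat}) (r : K) (v : 'rV[K]_n) :
  entries_le r v -> `|monomial_at m v| <= r ^+ total_degree m.
Proof.
move=> vr; apply: (monomial_ind (P := fun k g => `|g v| <= r ^+ k)).
  by rewrite expr0 normr1.
by move=> i k g gv; rewrite exprS; apply: norm_mul_le.
Qed.

Lemma sum_half_pow_le N : \sum_(j < N) (2^-1 : K) ^+ j <= 2.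
Proof.
suff -> : \sum_(j < N) (2^-1 : K) ^+ j = 2 - 2 * 2^-1 ^+ N.
  by rewrite gerBl mulr_ge0// exprn_ge0// invr_ge0.
elim: N => [|N IHN]; first by rewrite big_ord0 expr0 mulr1 subrr.
rewrite big_ord_recr/= IHN exprS; by field.
Qed.

Lemma sum_half_degree_le n (A : {fset {ffun 'I_n -> nat}}) :
  \sum_(m : A) (2^-1 : K) ^+ total_degree (val m) <= 2 ^+ n.
Proof.
pose N := (\max_(m : A) \max_i (val m) i)%N.
pose enc (m : A) : {ffun 'I_n -> 'I_N.+1} := [ffun i => inord (val m i)].
have encE (m : A) i : enc m i = val m i :> nat.
  rewrite ffunE inordK// ltnS /N.
  exact: leq_trans (leq_bigmax (F := fun i => val m i) i)
    (leq_bigmax (F := fun m : A => \max_i (val m) i)%N m).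
have enc_inj : injective enc.
  move=> m m' e; apply: val_inj; apply/ffunP => i.
  by rewrite -!encE e.
pose G (f : {ffun 'I_n -> 'I_N.+1}) : K := \prod_i 2^-1 ^+ f i.
have -> : \sum_(m : A) (2^-1 : K) ^+ total_degree (val m) =
    \sum_(f in enc @: [set: A]%SET) G f.
  rewrite big_imset/=; last by move=> x y _ _; apply: enc_inj.
  apply: eq_big => [m|m _]; first by rewrite inE.
  rewrite /G /total_degree -expr_sum; congr (_ ^+ _).
  by apply: eq_bigr => i _; rewrite encE.
apply: le_trans (_ : \sum_f G f <= _).
  rewrite big_mkcond; apply: ler_sum => f _.
  by case: ifP => // _; apply: prodr_ge0 => i _; rewrite exprn_ge0// invr_ge0.
rewrite -(bigA_distr_bigA (fun (i : 'I_n) (j : 'I_N.+1) => 2^-1 ^+ j)).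
apply: le_trans (_ : \prod_(i < n) (2 : K) <= _); last by rewrite prodr_const card_ord.
apply: ler_prod => i _; rewrite sum_half_pow_le andbT.
by apply: sumr_ge0 => j _; rewrite exprn_ge0// invr_ge0.
Qed.

Lemma norm_lim_totally (I : choiceType) (g : {fset I} -> K) (l M : K)
    (A0 : {fset I}) :
  g @ totally --> l -> (forall A, (A0 `<=` A)%fset -> `|g A| <= M) -> `|l| <= M.
Proof.
move=> gl gM; have M0 : 0 <= M by exact: le_trans (normr_ge0 _) (gM A0 (fsubset_refl _)).
rewrite real_leNgt ?realE ?normr_ge0 ?M0//; apply/negP => Ml.
have e0 : 0 < `|l| - M by rewrite subr_gt0.
move: gl => /cvgrPdist_lt/(_ _ e0)[A1 _ A1P].
have := A1P (A0 `|` A1)%fset (fsubsetUr _ _); rewrite /= => /lt_geF/negbT/negP; apply.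
rewrite lerBlDr (le_trans _ (lerD (lexx _) (gM _ (fsubsetUl A0 A1))))//.
by rewrite -[X in `|X| <= _](subrK (g (A0 `|` A1)%fset)) ler_normD.
Qed.

Lemma partial_sum_bounded_terms (I : choiceType) (x : I -> K) (l : K) :
  partial_sum x @ totally --> l -> exists2 C, 0 <= C & forall i, `|x i| <= C.
Proof.
move=> /cvgrPdist_lt/(_ _ ltr01)[A _ AP].
exists (2 + \sum_(i : A) `|x (val i)|); first by rewrite addr_ge0// sumr_ge0.
move=> i; have [iA|iA] := boolP (i \in A).
  rewrite (bigD1 [` iA]%fset)//= addrCA lerDl addr_ge0// sumr_ge0// => j _.
have l1 := AP _ (fsubset_refl A).
have l2 := AP (i |` A)%fset (fsubsetU1 i A).
have xE : x i = (l - partial_sum x A) - (l - partial_sum x (i |` A)%fset).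
  rewrite /partial_sum -!(big_seq_fsetE _ _ xpredT x) big_fsetU1//=; ring.
apply: le_trans (_ : 1 + 1 <= _).
  rewrite xE; apply: le_trans (ler_normB _ _) _.
  by apply: lerD; apply: ltW.
by rewrite lerDl sumr_ge0.
Qed.

Lemma nbhs_entries n (w : 'rV[K]_n) (U : set 'rV[K]_n) : nbhs w U ->
  exists2 r : K, 0 < r & forall v, entries_le r v -> U (w + v).
Proof.
move=> /nbhs_ballP[e /= e0 eU]; exists (e / 2); first by rewrite divr_gt0.
move=> v ve; apply: eU; split=> // i j; rewrite ord1 /ball/= !mxE opprD addNKr normrN.
by rewrite (le_lt_trans (ve j))// gtr_pMr// invf_lt1// ltr1n.
Qed.

Lemma entries_nbhs n (w : 'rV[K]_n) (r : K) : 0 < r ->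
  \forall z \near w, entries_le r (z - w).
Proof.
move=> r0; apply/nbhs_ballP; exists r => // z [_ wz] j.
by rewrite !mxE distrC ltW//; apply: wz.
Qed.

Lemma holomorphic_near_bound n (f : 'rV[K]_n -> K) (w : 'rV[K]_n) :
  holomorphic_near f w ->
  exists (r C : K) (a : {ffun 'I_n -> nat} -> K),
  [/\ 0 < r, 0 <= C, forall m, `|a m| * r ^+ total_degree m <= C
    & forall v, entries_le r v ->
      partial_sum (fun m => a m * monomial_at m v) @ totally --> f (w + v)].
Proof.
move=> [a /nbhs_entries[r r0 ra]].
have cv v : entries_le r v ->
    partial_sum (fun m => a m * monomial_at m v) @ totally --> f (w + v).
  by move=> /ra; rewrite addrAC subrr add0r.
have [|C C0 aC] := partial_sum_bounded_terms (cv (const_mx r) _).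
  by move=> j; rewrite mxE gtr0_norm.
exists r, C, a; split => // m; have := aC m; rewrite normrM.
congr (_ * _ <= _); rewrite /monomial_at /total_degree.
rewrite normr_prod expr_sum; apply: eq_bigr => i _.
by rewrite mxE normrX gtr0_norm.
Qed.

(* On the polydisc of radius [r / 4] the majorant of the series is geometric of
   ratio [1 / 2]. *)
Lemma partial_sum_le n (r C : K) (a c : {ffun 'I_n -> nat} -> K) (B : K)
    (A : {fset {ffun 'I_n -> nat}}) :
  0 < r -> 0 <= B ->
  (forall m, `|a m| * r ^+ total_degree m <= C) ->
  (forall m, `|c m| <= B * (2 * (r / 4)) ^+ total_degree m) ->
  `|partial_sum (fun m => a m * c m) A| <= C * B * 2 ^+ n.
Proof.
move=> r0 B0 aC cB.
have C0 : 0 <= C by apply: le_trans (aC [ffun=> 0%N]); rewrite mulr_ge0// exprn_ge0// ltW.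
apply: le_trans (ler_norm_sum _ _ _) _.
apply: le_trans (_ : C * B * \sum_(m : A) (2^-1 : K) ^+ total_degree (val m) <= _); last first.
  by rewrite ler_wpM2l ?mulr_ge0// sum_half_degree_le.
rewrite mulr_sumr; apply: ler_sum => m _; rewrite normrM.
apply: le_trans (ler_wpM2l (normr_ge0 _) (cB _)) _.
have -> : 2 * (r / 4) = r * 2^-1 by field.
rewrite exprMn; set p := r ^+ _; set q := 2^-1 ^+ _.
have -> : `|a (val m)| * (B * (p * q)) = (`|a (val m)| * p) * (B * q) by ring.
rewrite -[C * B * _]mulrA; apply: ler_wpM2r; last exact: aC.
by rewrite mulr_ge0// exprn_ge0// invr_ge0.
Qed.

Lemma second_difference_continuous n (f : 'rV[K]_n -> K) (w : 'rV[K]_n) :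
  holomorphic_near f w ->
  exists rho C : K, [/\ 0 < rho, 0 <= C & forall (a b : K) (d h : 'rV[K]_n),
    0 <= a <= 1 -> 0 <= b <= 1 ->
    entries_le (a * rho) d -> entries_le (b * rho) h ->
    `|second_difference f (w + d) h - second_difference f w h|
      <= C * (a * b ^+ 2)].
Proof.
move=> /holomorphic_near_bound[r [C [c [r0 C0 cC cvg_c]]]].
exists (r / 4), (C * 2 * 2 ^+ n); split; first by rewrite divr_gt0.
  by rewrite !mulr_ge0// exprn_ge0.
move=> a b d h a01 b01 da hb.
have [[a0 a1] [b0 b1]] := (andP a01, andP b01).
have r40 : 0 <= r / 4 by rewrite divr_ge0// ltW.
have le_r (v : 'rV[K]_n) (e : K) : e <= 2 -> entries_le (e * (r / 4)) v -> entries_le r v.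
  move=> e2 ve j; apply: le_trans (ve j) _.
  apply: le_trans (ler_wpM2r r40 e2) _.
  have -> : 2 * (r / 4) = r / 2 by field.
  by rewrite ler_pdivrMr// ler_peMr ?(ltW r0)// ler1n.
have dh : entries_le ((a + b) * (r / 4)) (d + h).
  by move=> j; rewrite mxE mulrDl norm_add_le.
have dNh : entries_le ((a + b) * (r / 4)) (d - h).
  by move=> j; rewrite !mxE mulrDl norm_add_le// normrN.
have Nh : entries_le (b * (r / 4)) (- h) by move=> j; rewrite mxE normrN.
have z0 : entries_le (0 * (r / 4)) (0 : 'rV[K]_n).
  by move=> j; rewrite mxE normr0 mul0r.
have ab2 : a + b <= 2 by rewrite [2]mulr2n lerD.
have le12 : 1 <= 2 :> K by rewrite ler1n.
have a2 := le_trans a1 le12; have b2 := le_trans b1 le12.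
have S1 := cvg_c _ (le_r _ _ ab2 dh); have S2 := cvg_c _ (le_r _ _ ab2 dNh).
have S3 := cvg_c _ (le_r _ _ a2 da); have S4 := cvg_c _ (le_r _ _ b2 hb).
have S5 := cvg_c _ (le_r _ _ b2 Nh); have S6 := cvg_c _ (le_r _ _ (ler0n _ 2) z0).
pose e m := second_difference (monomial_at m) d h - second_difference (monomial_at m) 0 h.
have S : partial_sum (fun m => c m * e m) @ totally -->
    second_difference f (w + d) h - second_difference f w h.
have -> : second_difference f (w + d) h - second_difference f w h =
  f (w + (d + h)) + f (w + (d - h)) - 2 * f (w + d)
    - (f (w + h) + f (w + - h) - 2 * f (w + 0)).
  by rewrite /second_difference addr0 !addrA.
  have -> : partial_sum (fun m => c m * e m) = fun A =>
    partial_sum (fun m => c m * monomial_at m (d + h)) A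
      + partial_sum (fun m => c m * monomial_at m (d - h)) A
      - 2 * partial_sum (fun m => c m * monomial_at m d) A
    - (partial_sum (fun m => c m * monomial_at m h) A
      + partial_sum (fun m => c m * monomial_at m (- h)) A
      - 2 * partial_sum (fun m => c m * monomial_at m 0) A).
    apply: funext => A; rewrite /partial_sum !mulr_sumr -!big_split/= -!sumrB.
    by apply: eq_bigr => m _; rewrite /e /second_difference !add0r; ring.
  exact: cvgB (cvgB (cvgD S1 S2) (cvgMl_tmp (a := 2) S3))
    (cvgB (cvgD S4 S5) (cvgMl_tmp (a := 2) S6)).
apply: (norm_lim_totally (A0 := fset0) S) => A _.
have -> : C * 2 * 2 ^+ n * (a * b ^+ 2) = C * (2 * a * b ^+ 2) * 2 ^+ n by ring.
apply: (partial_sum_le _ r0 _ cC) => [|m]; first by rewrite !mulr_ge0// exprn_ge0.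
exact: monomial_second_difference.
Qed.

Lemma total_degree_eq0 n (m : {ffun 'I_n -> nat}) :
  (total_degree m == 0%N) = [forall i, m i == 0%N].
Proof. by rewrite sum_nat_eq0; apply: eq_forallb => i. Qed.

Lemma first_order_expansion n (f : 'rV[K]_n -> K) (w : 'rV[K]_n) :
  holomorphic_near f w ->
  exists (rho C : K) (L : 'I_n -> K), [/\ 0 < rho, 0 <= C &
    forall (b : K) (h : 'rV[K]_n), 0 <= b <= 1 -> entries_le (b * rho) h ->
    `|f (w + h) - f w - \sum_i L i * h 0 i| <= C * b ^+ 2].
Proof.
move=> /holomorphic_near_bound[r [C [c [r0 C0 cC cvg_c]]]].
pose unit_index (i : 'I_n) : {ffun 'I_n -> nat} := [ffun j => (j == i) : nat].
exists (r / 4), (C * 2 ^+ n), (fun i => c (unit_index i)); split; first by rewrite divr_gt0.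
  by rewrite !mulr_ge0// exprn_ge0.
move=> b h /andP[b0 b1] hb.
have r40 : 0 <= r / 4 by rewrite divr_ge0// ltW.
have hr4 : entries_le (r / 4) h.
  by move=> j; rewrite (le_trans (hb j))// ler_piMl.
have hr : entries_le r h.
  move=> j; rewrite (le_trans (hr4 j))// ler_pdivrMr// ler_peMr ?(ltW r0)//.
  by rewrite ler1n.
have r0' : entries_le r (0 : 'rV[K]_n) by move=> j; rewrite mxE normr0 ltW.
pose e m := monomial_at m h - monomial_at m 0
  - \sum_i (m == unit_index i)%:R * h 0 i.
have mon0 m : monomial_at m (0 : 'rV[K]_n) = (total_degree m == 0%N)%:R.
  have [/eqP|] := eqVneq (total_degree m) 0%N.
    rewrite total_degree_eq0 => /forallP m0; rewrite /monomial_at big1// => i _.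
    by rewrite (eqP (m0 i)) expr0.
  rewrite total_degree_eq0 => /forallPn[i mi]; rewrite /monomial_at (bigD1 i)//=.
  by rewrite mxE expr0n (negPf mi) mul0r.
have e_le m : `|e m| <= b ^+ 2 * (2 * (r / 4)) ^+ total_degree m.
  have [m0|m0] := eqVneq (total_degree m) 0%N.
    have mi i : m i = 0%N.
      by move/eqP: m0; rewrite total_degree_eq0 => /forallP/(_ i)/eqP.
    rewrite /e mon0 m0 eqxx /monomial_at big1 => [|i _]; last by rewrite mi expr0.
    rewrite subrr sub0r big1 => [|i _].
      by rewrite oppr0 normr0 mulr_ge0// exprn_ge0// mulr_ge0.
    case: eqP => [/ffunP/(_ i)|_]; last by rewrite mul0r.
    by rewrite mi ffunE eqxx.
  have [m1|m1] := eqVneq (total_degree m) 1%N.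
    have [i mE] : exists i, m = unit_index i.
      have [i mi] : exists i, m i != 0%N.
        by apply/existsP; rewrite -negb_forall -total_degree_eq0.
      exists i; apply/ffunP => j; rewrite ffunE; move: m1.
      rewrite /total_degree (bigD1 i)//=; have [->|ji] := eqVneq j i.
        by case: (m i) mi => [//|[//|k]]; rewrite addSn.
      rewrite (bigD1 j)//=; case: (m i) mi => // k _.
      by case: (m j) => // l; rewrite addSn addnCA.
    have uI j : (m == unit_index j) = (j == i).
      apply/eqP/eqP => [|->//]; rewrite mE => /ffunP/(_ j).
      by rewrite !ffunE eqxx; case: eqP.
    rewrite /e mon0 m1 subr0 (bigD1 i)//= uI eqxx mul1r big1 => [|j ji].
      rewrite addr0 /monomial_at (bigD1 i)//= big1 => [|j ji].
        rewrite mulr1 mE ffunE eqxx subrr normr0.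
        by rewrite mulr_ge0// exprn_ge0// mulr_ge0.
      by rewrite mE ffunE (negPf ji).
    by rewrite uI (negPf ji) mul0r.
  rewrite /e mon0 (negPf m0) subr0 big1 => [|i _]; last first.
    case: eqP => [mE|_]; last by rewrite mul0r.
    case/eqP: m1; rewrite mE /total_degree (bigD1 i)//= big1 => [|j ji].
      by rewrite ffunE eqxx.
    by rewrite ffunE (negPf ji).
  rewrite subr0; apply: le_trans (monomial_le m hb) _; rewrite exprMn.
  apply: ler_pM; rewrite ?exprn_ge0//.
    by apply: ler_wiXn2l => //; case: total_degree m0 m1 => [|[]].
  by apply: lerXn2r; rewrite ?nnegrE ?(mulr_ge0 (ler0n _ 2) r40)// ler_peMl// ler1n.
have S : partial_sum (fun m => c m * e m) @ totally -->
    f (w + h) - f w - \sum_i c (unit_index i) * h 0 i.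
  have -> : partial_sum (fun m => c m * e m) = fun A =>
    partial_sum (fun m => c m * monomial_at m h) A
      - partial_sum (fun m => c m * monomial_at m 0) A
      - \sum_i partial_sum (fun m => c m * ((m == unit_index i)%:R * h 0 i)) A.
    apply: funext => A; rewrite /partial_sum exchange_big/= -!sumrB.
    by apply: eq_bigr => m _; rewrite /e !mulrBr mulr_sumr.
  have -> : f w = f (w + 0) by rewrite addr0.
  apply: cvgB; first exact: cvgB (cvg_c _ hr) (cvg_c _ r0').
  apply: cvg_near_cst.
  exists [fset unit_index i | i in 'I_n]%fset => // A sA.
  have partial_sumE i :
      partial_sum (fun m => c m * ((m == unit_index i)%:R * h 0 i)) A
      = c (unit_index i) * h 0 i.
    have iA : unit_index i \in A.
      by apply: (fsubsetP sA); apply/imfsetP; exists i.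
    rewrite /partial_sum (bigD1 [` iA]%fset)//= eqxx mul1r big1 ?addr0// => j ji.
    have -> : (val j == unit_index i) = false.
      by apply: contraNF ji => /eqP ji; apply/eqP/val_inj.
    by rewrite mul0r mulr0.
  exact: (eq_bigr _ (fun i _ => partial_sumE i)).
apply: (norm_lim_totally (A0 := fset0) S) => A _.
have -> : C * 2 ^+ n * b ^+ 2 = C * b ^+ 2 * 2 ^+ n by ring.
by apply: (partial_sum_le _ r0 _ cC) => //; rewrite exprn_ge0.
Qed.

Lemma exists_pos_le (x y : K) : 0 < x -> 0 < y ->
  exists z : K, [/\ 0 < z, z <= x & z <= y].
Proof.
move=> x0 y0; have xy0 : 0 < x + y by rewrite addr_gt0.
exists (x * y / (x + y)); split; first by rewrite divr_gt0// mulr_gt0.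
- by rewrite ler_pdivrMr// ler_pM2l// lerDr ltW.
- by rewrite ler_pdivrMr// mulrC ler_pM2l// lerDl ltW.
Qed.

Lemma exists_pos_le_ord n (e : 'I_n -> K) : (forall j, 0 < e j) ->
  exists2 z : K, 0 < z & forall j, z <= e j.
Proof.
move=> e0; have s0 : 0 < 1 + \sum_j (e j)^-1.
  by rewrite ltr_wpDr// sumr_ge0// => j _; rewrite invr_ge0 ltW.
exists (1 + \sum_j (e j)^-1)^-1; first by rewrite invr_gt0.
move=> j; rewrite -[leRHS]invrK lef_pV2 ?posrE ?invr_gt0//.
rewrite (bigD1 j)//= addrCA lerDl addr_ge0// sumr_ge0// => i _.
by rewrite invr_ge0 ltW.
Qed.

Lemma map_first_order_expansion n p (f : 'rV[K]_n -> 'rV[K]_p) (w : 'rV[K]_n) :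
  holomorphic_map_near f w ->
  exists (rho C : K) (L : 'I_p -> 'I_n -> K), [/\ 0 < rho, 0 <= C &
    forall (b : K) (h : 'rV[K]_n) j, 0 <= b <= 1 -> entries_le (b * rho) h ->
    [/\ `|f (w + h) 0 j - f w 0 j - \sum_i L j i * h 0 i| <= C * b ^+ 2,
        `|\sum_i L j i * h 0 i| <= C * b
      & `|f (w + h) 0 j - f w 0 j| <= C * b]].
Proof.
move=> fP; have /fin_all_exists[rho] := fun j => first_order_expansion (fP j).
move=> /fin_all_exists[C] /fin_all_exists[L] rCL.
have rho0 j : 0 < rho j by have [] := rCL j.
have C0 j : 0 <= C j by have [] := rCL j.
have [r r0 rr] := exists_pos_le_ord rho0.
pose B := \sum_j \sum_i `|L j i| * r.
have B0 : 0 <= B.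
  by apply: sumr_ge0 => j _; apply: sumr_ge0 => i _; rewrite mulr_ge0// ltW.
exists r, (\sum_j C j + B), L; split => // [|b h j b01 hb].
  by rewrite addr_ge0// sumr_ge0.
have /andP[b0 b1] := b01.
have Cj : C j <= \sum_j C j by rewrite (bigD1 j)//= lerDl sumr_ge0.
have E1 : `|f (w + h) 0 j - f w 0 j - \sum_i L j i * h 0 i|
    <= (\sum_j C j) * b ^+ 2.
  have [_ _ /(_ b h b01)] := rCL j.
  move=> /(_ _)/le_trans; apply.
    by move=> i; rewrite (le_trans (hb i))// ler_wpM2l.
  by rewrite ler_wpM2r// exprn_ge0.
have E2 : `|\sum_i L j i * h 0 i| <= B * b.
  apply: le_trans (ler_norm_sum _ _ _) _.
  apply: le_trans (_ : (\sum_i `|L j i| * r) * b <= _).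
    rewrite mulr_suml; apply: ler_sum => i _; rewrite normrM -mulrA.
    by rewrite ler_wpM2l// mulrC.
  rewrite ler_wpM2r// /B [leRHS](bigD1 j)//= lerDl sumr_ge0// => k _.
  by apply: sumr_ge0 => i _; rewrite mulr_ge0// ltW.
split.
- by apply: le_trans E1 _; rewrite ler_wpM2r ?exprn_ge0// lerDl.
- by apply: le_trans E2 _; rewrite ler_wpM2r// lerDr sumr_ge0.
- rewrite -[X in `|X|](subrK (\sum_i L j i * h 0 i)).
  apply: le_trans (norm_add_le E1 E2) _; rewrite mulrDl lerD2r.
  by rewrite ler_wpM2l ?sumr_ge0// expr2 ler_piMl.
Qed.

Lemma scalar_first_order_expansion n (f : 'rV[K]_n -> K) (w : 'rV[K]_n) :
  holomorphic_near f w ->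
  exists rho C : K, [/\ 0 < rho, 0 <= C &
    forall (b : K) (h : 'rV[K]_n), 0 <= b <= 1 -> entries_le (b * rho) h ->
    `|f (w + h) - f w| <= C * b].
Proof.
move=> fP; have fP' : holomorphic_map_near (fun z => \row_(j < 1) f z) w.
  by move=> j; under [X in holomorphic_near X]funext do rewrite mxE.
have [rho [C [L [rho0 C0 CP]]]] := map_first_order_expansion fP'.
exists rho, C; split => // b h b01 hb.
by have [_ _] := CP b h 0 b01 hb; rewrite !mxE.
Qed.

Lemma norm_le_trans3 (x a b c : K) : `|x| <= a -> a = b -> b <= c -> `|x| <= c.
Proof. by move=> ? <-; apply: le_trans. Qed.

Lemma E6t_equation_expansion (a B b : K) (z l : 'rV[K]_5) :
  0 <= B -> 0 <= b <= 1 ->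
  (forall j, [/\ `|z 0 j - l 0 j| <= B * b ^+ 2, `|l 0 j| <= B * b
     & `|z 0 j| <= B * b]) ->
  `|E6t_equation a z - (l 0 (inord 3) ^+ 2 + l 0 (inord 4) ^+ 2)|
    <= ((3 + `|a|) * B ^+ 3 + 4 * B ^+ 2) * b ^+ 3 /\
  `|E6t_equation a z| <= ((3 + `|a|) * B ^+ 3 + 2 * B ^+ 2) * b ^+ 2.
Proof.
move=> B0 /andP[b0 b1] zl.
have z_le j : `|z 0 j| <= B * b by have [] := zl j.
pose cub := z 0 (inord 0) ^+ 3 + z 0 (inord 1) ^+ 3 + z 0 (inord 2) ^+ 3
  + a * z 0 (inord 0) * z 0 (inord 1) * z 0 (inord 2).
have z3 j : `|z 0 j ^+ 3| <= B ^+ 3 * b ^+ 3.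
  by rewrite normrX -exprMn; apply: lerXn2r; rewrite ?nnegrE ?mulr_ge0.
have cub_le : `|cub| <= (3 + `|a|) * B ^+ 3 * b ^+ 3.
  have p3 : `|a * z 0 (inord 0) * z 0 (inord 1) * z 0 (inord 2)|
      <= `|a| * (B * b) * (B * b) * (B * b).
    by do 3 (apply: norm_mul_le => //).
  apply: norm_le_trans3 _ _ (lexx _).
    exact: norm_add_le (norm_add_le (norm_add_le (z3 _) (z3 _)) (z3 _)) p3.
  by ring.
have sq_le j : `|z 0 j ^+ 2| <= B ^+ 2 * b ^+ 2.
  by rewrite normrX -exprMn; apply: lerXn2r; rewrite ?nnegrE ?mulr_ge0.
have dsq j : `|z 0 j ^+ 2 - l 0 j ^+ 2| <= 2 * B ^+ 2 * b ^+ 3.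
  have [d1 d2 d3] := zl j; rewrite subr_sqr.
  apply: norm_le_trans3 (norm_mul_le d1 (norm_add_le d3 d2)) _ (lexx _); ring.
split.
  have -> : E6t_equation a z - (l 0 (inord 3) ^+ 2 + l 0 (inord 4) ^+ 2) =
    cub + (z 0 (inord 3) ^+ 2 - l 0 (inord 3) ^+ 2)
      + (z 0 (inord 4) ^+ 2 - l 0 (inord 4) ^+ 2).
    by rewrite /E6t_equation /cub; ring.
  apply: norm_le_trans3 (norm_add_le (norm_add_le cub_le (dsq _)) (dsq _)) _ (lexx _).
  by ring.
have cub_le2 : `|cub| <= (3 + `|a|) * B ^+ 3 * b ^+ 2.
  apply: le_trans cub_le _; rewrite ler_wpM2l ?mulr_ge0 ?addr_ge0 ?exprn_ge0//.
  by rewrite exprS ler_piMl// exprn_ge0.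
apply: norm_le_trans3 _ _ (lexx _).
  exact: norm_add_le (norm_add_le cub_le2 (sq_le (inord 3))) (sq_le (inord 4)).
by ring.
Qed.

Lemma class_E6t_expansion (f : 'rV[K]_5 -> K) (y : 'rV[K]_5) :
  class_E6t f y ->
  exists (u0 : K) (l l' : 'I_5 -> K) (rho C : K), [/\ 0 < rho, 0 <= C &
    forall (b : K) (h : 'rV[K]_5), 0 <= b <= 1 -> entries_le (b * rho) h ->
    `|f (y + h) - u0 * ((\sum_i l i * h 0 i) ^+ 2 + (\sum_i l' i * h 0 i) ^+ 2)|
      <= C * b ^+ 3].
Proof.
move=> [a _ [phi [psi [u [[_ psiH uH] [[_ psiy _ phipsi] [_ fphi]]]]]]].
have [r1 [B [L [r10 B0 psiP]]]] := map_first_order_expansion psiH.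
have [r2 [D [r20 D0 uP]]] := scalar_first_order_expansion uH.
have [r3 r30 phipsiP] := nbhs_entries phipsi.
have [r4 r40 fphiP] := nbhs_entries fphi.
have [r5 [r50 r52 r54]] := exists_pos_le r20 r40.
have B10 : 0 < B + 1 by rewrite ltr_wpDl.
have [t0' [t0'0 t0'1 t0'B]] := exists_pos_le (ltr01 : 0 < 1 :> K) (divr_gt0 r50 B10).
have [t [tgt0 tt0 tr3]] := exists_pos_le t0'0 (divr_gt0 r30 r10).
have t0 := ltW tgt0; have t1 := le_trans tt0 t0'1.
have Bt : B * t <= r5.
  apply: le_trans (_ : (B + 1) * t <= _); first by rewrite ler_wpM2r// lerDl.
  by rewrite mulrC -ler_pdivlMr// (le_trans tt0 t0'B).
pose E := (3 + `|a|) * B ^+ 3.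
exists (u 0), (L (inord 3)), (L (inord 4)), (t * r1).
exists (D * B / r2 * (E + 2 * B ^+ 2) + `|u 0| * (E + 4 * B ^+ 2)).
have E0 : 0 <= E by rewrite mulr_ge0 ?addr_ge0 ?exprn_ge0.
have F0 : 0 <= D * B / r2 by rewrite divr_ge0 ?mulr_ge0// ltW.
have B20 : 0 <= B ^+ 2 by rewrite exprn_ge0.
split; first by rewrite mulr_gt0.
  by apply: addr_ge0; apply: mulr_ge0 => //; apply: addr_ge0 => //; apply: mulr_ge0.
move=> b h b01 hb; have /andP[b0 b1] := b01.
have bt01 : 0 <= b * t <= 1 by rewrite mulr_ge0//= mulr_ile1.
have hbt : entries_le (b * t * r1) h by move=> i; rewrite -mulrA.
have hr3 : entries_le r3 h.
  move=> i; apply: le_trans (hb i) _; apply: le_trans (_ : t * r1 <= _).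
    by rewrite ler_piMl// mulr_ge0// ltW.
  by rewrite -ler_pdivlMr.
set z := psi (y + h).
pose l : 'rV[K]_5 := \row_j \sum_i L j i * h 0 i.
have b2 : (b * t) ^+ 2 <= b ^+ 2.
  by rewrite exprMn ler_piMr ?exprn_ge0// exprn_ile1.
have zl j : [/\ `|z 0 j - l 0 j| <= B * b ^+ 2, `|l 0 j| <= B * b
    & `|z 0 j| <= B * b].
  have [] := psiP _ _ j bt01 hbt; rewrite psiy !mxE !subr0 => p1 p2 p3.
  have btb : B * (b * t) <= B * b by rewrite ler_wpM2l// ler_piMr.
  split; [apply: le_trans p1 _|exact: le_trans btb|exact: le_trans btb].
  by rewrite ler_wpM2l.
have [e1 e2] := E6t_equation_expansion a B0 b01 zl.
rewrite !mxE -/E in e1 e2.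
have zB j : `|z 0 j| <= b * (B * t).
  have [_ _] := psiP _ _ j bt01 hbt; rewrite psiy !mxE !subr0.
  by rewrite mulrCA.
have zr4 : entries_le r4 z.
  move=> j; apply: le_trans (zB j) _; apply: le_trans (le_trans Bt r54).
  by rewrite ler_piMl// mulr_ge0.
have c01 : 0 <= b * (B * t) / r2 <= 1.
  rewrite divr_ge0 ?mulr_ge0 ?(ltW r20)//= ler_pdivrMr// mul1r.
  by apply: le_trans (le_trans Bt r52); rewrite ler_piMl// mulr_ge0.
have uz : `|u z - u 0| <= D * B / r2 * b.
  have := uP _ z c01; rewrite add0r => uz.
  apply: le_trans (uz _) _; first by move=> j; rewrite divfK ?gt_eqF.
  have -> : D * B / r2 * b = D * (b * B / r2) by ring.
  rewrite ler_wpM2l// ler_wpM2r ?invr_ge0 ?(ltW r20)// ler_wpM2l//.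
  by rewrite ler_piMr.
have -> : f (y + h) = u z * E6t_equation a z.
  have <- : phi z = y + h by apply: phipsiP.
  by have := fphiP z zr4; rewrite add0r.
set q := (\sum_i L (inord 3) i * h 0 i) ^+ 2 + _ in e1 *.
have -> : u z * E6t_equation a z - u 0 * q =
  (u z - u 0) * E6t_equation a z + u 0 * (E6t_equation a z - q) by ring.
apply: norm_le_trans3
  (norm_add_le (norm_mul_le uz e2) (norm_mul_le (lexx _) e1)) _ (lexx _).
by ring.
Qed.

Lemma deforms_to_E6t_quadratic_part (f q : 'rV[K]_5 -> K) (w : 'rV[K]_5) (e : K) :
  (forall (v : 'rV[K]_5) (t : K),
    second_difference f w (t *: v) = 2 * t ^+ 2 * q v) ->
  deforms_to_E6t f w -> 0 < e ->
  exists (u0 : K) (l l' : 'I_5 -> K), forall v : 'rV[K]_5, entries_le 1 v ->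
    `|q v - u0 * ((\sum_i l i * v 0 i) ^+ 2 + (\sum_i l' i * v 0 i) ^+ 2)| <= e.
Proof.
move=> fq [k [F [FH Ff FE]]] e0.
have [rho [C [rho0 C0 FP]]] := second_difference_continuous FH.
have [r1 r10 FfP] := nbhs_entries Ff.
pose e' := rho ^+ 2 * e.
have e'0 : 0 < e' by rewrite mulr_gt0// exprn_gt0.
pose a := e' / (C + e').
have Ce' : 0 < C + e' by rewrite ltr_wpDl.
have a0 : 0 < a by rewrite divr_gt0.
have a1 : a <= 1 by rewrite ler_pdivrMr// mul1r lerDr.
have Ca : C * a <= e' by rewrite mulrCA ler_piMr ?(ltW e'0)// ler_pdivrMr// mul1r lerDl ltW.
have ar0 : 0 < a * rho by rewrite mulr_gt0.
have [y [s [yU sV]]] := FE _ _ (entries_nbhs w ar0) (entries_nbhs 0 ar0).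
move=> /class_E6t_expansion[u0 [l [l' [rho' [C' [rho'0 C'0 gP]]]]]].
exists u0, l, l' => v v1.
set Q := u0 * _.
have r20 : 0 < rho' / rho by rewrite divr_gt0.
have r30 : 0 < r1 / rho by rewrite divr_gt0.
pose M := 4 * C' * (rho / rho') ^+ 3.
have M0 : 0 <= M.
  by apply: mulr_ge0; [exact: mulr_ge0|rewrite exprn_ge0// divr_ge0// ltW].
have M10 : 0 < M + 1 by rewrite ltr_wpDl.
have [b1 [b10 b11 b1r]] := exists_pos_le (ltr01 : 0 < 1 :> K) r20.
have [b2 [b20 b2r b2M]] := exists_pos_le r30 (divr_gt0 e'0 M10).
have [b [b0 bb1 bb2]] := exists_pos_le b10 b20.
have b01 : 0 <= b <= 1 by rewrite ltW//= (le_trans bb1).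
have bM : M * b <= e'.
  apply: le_trans (_ : b * (M + 1) <= _); first by rewrite mulrC ler_wpM2l ?(ltW b0)// lerDl.
  by rewrite -ler_pdivlMr// (le_trans bb2).
have br0 : 0 <= b * rho by rewrite mulr_ge0// ltW.
pose h := (b * rho) *: v.
have hb : entries_le (b * rho) h.
  by move=> j; rewrite mxE normrM (ger0_norm br0) ler_piMr.
have hr1 : entries_le r1 h.
  move=> j; apply: le_trans (hb j) _; rewrite -ler_pdivlMr//.
  by rewrite (le_trans bb2).
have Nhr1 : entries_le r1 (- h) by move=> j; rewrite mxE normrN.
pose d : 'rV[K]_(5 + k) := row_mx (y - w) s.
pose H : 'rV[K]_(5 + k) := row_mx h 0.
have dP : entries_le (a * rho) d.
  move=> j; rewrite -(splitK j) /d; case: (split j) => i /=.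
    by rewrite row_mxEl; apply: yU.
  by rewrite row_mxEr; have := sV i; rewrite subr0.
have HP : entries_le (b * rho) H.
  move=> j; rewrite -(splitK j) /H; case: (split j) => i /=.
    by rewrite row_mxEl.
  by rewrite row_mxEr mxE normr0.
have a01 : 0 <= a <= 1 by rewrite ltW.
have := FP a b d H a01 b01 dP HP.
have -> : second_difference F (row_mx w 0) H = 2 * (b * rho) ^+ 2 * q v.
  rewrite -fq /second_difference -/h /H opp_row_mx !add_row_mx oppr0 !addr0.
  have {}FfP x : entries_le r1 x -> F (row_mx (w + x) 0) = f (w + x) by exact: FfP.
  have r1z : entries_le r1 (0 : 'rV[K]_5) by move=> j; rewrite mxE normr0 ltW.
  by have := FfP _ r1z; rewrite addr0 => ->; rewrite !FfP.
pose g z := F (row_mx z s).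
have -> : second_difference F (row_mx w 0 + d) H =
    g (y + h) + g (y - h) - 2 * g y.
  rewrite /second_difference /H /d opp_row_mx !add_row_mx oppr0 !addr0 add0r.
  by rewrite [w + _]addrC subrK.
pose b' := b * (rho / rho').
have b'01 : 0 <= b' <= 1.
  have rr0 : 0 < rho / rho' by rewrite divr_gt0.
  rewrite /b' mulr_ge0 ?(ltW b0) ?(ltW rr0)//= -ler_pdivlMr// invf_div mul1r.
  by rewrite (le_trans bb1).
have b'E : b' * rho' = b * rho by rewrite /b' -mulrA divfK ?gt_eqF.
have hb' : entries_le (b' * rho') h by rewrite b'E.
have Nhb' : entries_le (b' * rho') (- h) by move=> j; rewrite mxE normrN.
have zb' : entries_le (b' * rho') (0 : 'rV[K]_5).
  by move=> j; rewrite mxE normr0 b'E.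
have sumE (c : 'I_5 -> K) : \sum_i c i * h 0 i = b * rho * \sum_i c i * v 0 i.
  by rewrite mulr_sumr; apply: eq_bigr => i _; rewrite mxE mulrCA.
have sumNE (c : 'I_5 -> K) : \sum_i c i * (- h) 0 i = - (b * rho * \sum_i c i * v 0 i).
  by rewrite -sumE -sumrN; apply: eq_bigr => i _; rewrite mxE mulrN.
have sum0E (c : 'I_5 -> K) : \sum_i c i * (0 : 'rV[K]_5) 0 i = 0.
  by rewrite big1// => i _; rewrite mxE mulr0.
have := gP b' h b'01 hb'; have := gP b' (- h) b'01 Nhb'; have := gP b' 0 b'01 zb'.
rewrite !sumE !sumNE !sum0E addr0 -/(g _) -/(g (y + h)) -/(g (y - h)).
rewrite expr0n/= addr0 mulr0 subr0 sqrrN sqrrN !exprMn -mulrDr mulrCA -/Q.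
move=> g0 gN gh FPb.
have g20 : `|(2 : K)| <= 2 by rewrite ger0_norm.
rewrite -normrN in g0; rewrite -normrN in FPb.
have T0 : 0 < 2 * (b ^+ 2 * rho ^+ 2) by rewrite !mulr_gt0// exprn_gt0.
rewrite -(ler_pM2l T0) -{1}(gtr0_norm T0) -normrM.
have -> : 2 * (b ^+ 2 * rho ^+ 2) * (q v - Q) =
    - (g (y + h) + g (y - h) - 2 * g y - 2 * (b ^+ 2 * rho ^+ 2) * q v)
  + (g (y + h) - u0 * (b ^+ 2 * rho ^+ 2 *
       ((\sum_i l i * v 0 i) ^+ 2 + (\sum_i l' i * v 0 i) ^+ 2))
    + (g (y - h) - u0 * (b ^+ 2 * rho ^+ 2 *
       ((\sum_i l i * v 0 i) ^+ 2 + (\sum_i l' i * v 0 i) ^+ 2)))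
    + 2 * - g y) by rewrite /Q; ring.
have bounds := norm_add_le FPb
  (norm_add_le (norm_add_le gh gN) (norm_mul_le g20 g0)).
apply: le_trans bounds _; apply: le_trans (_ : b ^+ 2 * (C * a + M * b) <= _).
  by rewrite le_eqVlt; apply/orP; left; apply/eqP; rewrite /M exprMn; ring.
have -> : 2 * (b ^+ 2 * rho ^+ 2) * e = b ^+ 2 * (e' + e') by rewrite /e'; ring.
by rewrite ler_wpM2l ?exprn_ge0 ?(ltW b0)// lerD.
Qed.

End PowerSeries.
End PowerSeries.

Lemma deforms_to_E6t_type_S6 (K : numFieldType) (F : mpoly.mpoly 6 K) :
  cubic_form F -> has_singularity_deforming_to_E6t F -> type_S6 F.
Proof.
move=> [_ F3] [i [y [singy defy]]].
apply: (TrilinearForms.singular_type_S6 F3 singy) => e e0.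
apply: (PowerSeries.deforms_to_E6t_quadratic_part _ defy e0) => v t.
exact: TrilinearForms.local_equation_second_difference.
Qed.

From mathcomp Require Import reals mpoly.
From mathcomp.real_closed Require Import complex.

Theorem lemma5p4 (R : realType) (F : {mpoly (complex R)[6]}) :
  cubic_form F ->
  has_singularity_deforming_to_E6t F ->
  type_S6 F /\ ~ properly_stable F.
Proof.
move=> F_cubic F_sing; have F_S6 := deforms_to_E6t_type_S6 F_cubic F_sing.
by split => //; apply: Unstable.type_S6_not_properly_stable.
Qed.
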